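(* Let $a$ be a real number with $0\le a<1$ and let $p$ be a prime number. Then the set of real numbers $\alpha$ such that $$\liminf_{q\to+\infty}\, q\,(\log q)^{2-a}\,\|q\alpha\|\,|q|_p\,\bigl(\log(2/|q|_p)\bigr)^a>0$$ (where $q$ runs over positive integers) has Hausdorff dimension $1$.
   Context: For a real number $x$, $\|x\|$ denotes the distance from $x$ to the nearest integer. For a prime $p$, $|\cdot|_p$ is the $p$-adic absolute value normalized so that $|p|_p=p^{-1}$. *)

(* Defs.v *)
From Stdlib Require Import Reals Lra Lia ZArith Znumtheory.
Open Scope R_scope.

Definition dist_nint (x : R) : R :=
  Rmin (x - IZR (Int_part x)) (IZR (Int_part x) + 1 - x).

(* p-adic valuation of a natural number q (meaningful for p >= 2, q >= 1);
   the fuel q suffices since p^k | q, q >= 1 forces k <= q. *)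
Fixpoint vp_aux (fuel p q : nat) : nat :=
  match fuel with
  | O => O
  | S f => if (q =? 0)%nat then O
           else if (q mod p =? 0)%nat then S (vp_aux f p (q / p))
           else O
  end.
Definition vp (p q : nat) : nat := vp_aux q p q.

Definition padic_abs (p q : nat) : R := / (INR p ^ vp p q).

(* liminf_{q -> +oo} f q > 0  (liminf in [-oo,+oo]), written out:
   sup_N inf_{q >= N} f q > 0. *)
Definition liminf_pos (f : nat -> R) : Prop :=
  exists c : R, 0 < c /\ exists N : nat, forall q : nat, (N <= q)%nat -> c <= f q.

(* d^s with the convention 0^s = 0 (Stdlib's Rpower 0 s would be 1). *)
Definition hpow (d s : R) : R := if Rle_dec d 0 then 0 else Rpower d s.

(* A countable delta-cover (U n)_n of E, with d n an upper bound of diam (U n),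
   d n <= delta, and Sum_n (d n)^s <= M. Taking d n = diam (U n) is optimal since
   hpow is nondecreasing in d for s >= 0, so the infimum over such covers is
   the usual H^s_delta. *)
Definition delta_cover_sum_le (s delta : R) (E : R -> Prop) (M : R) : Prop :=
  exists (U : nat -> R -> Prop) (d : nat -> R),
    (forall n, 0 <= d n <= delta) /\
    (forall n x y, U n x -> U n y -> Rabs (x - y) <= d n) /\
    (forall x, E x -> exists n, U n x) /\
    (forall N, sum_f_R0 (fun n => hpow (d n) s) N <= M).

Definition Hdelta_le (s delta : R) (E : R -> Prop) (M : R) : Prop :=
  forall eps, 0 < eps -> delta_cover_sum_le s delta E (M + eps).

Definition Hausdorff_le (s : R) (E : R -> Prop) (M : R) : Prop :=
  forall delta, 0 < delta -> Hdelta_le s delta E M.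

Definition Hausdorff_null (s : R) (E : R -> Prop) : Prop := Hausdorff_le s E 0.

Definition is_glb (A : R -> Prop) (m : R) : Prop :=
  (forall x, A x -> m <= x) /\ (forall b, (forall x, A x -> b <= x) -> b <= m).

Definition is_hausdorff_dim (E : R -> Prop) (dim : R) : Prop :=
  is_glb (fun s => 0 <= s /\ Hausdorff_null s E) dim.

Definition good_set (a : R) (p : nat) : R -> Prop :=
  fun alpha => liminf_pos (fun q =>
    INR q * Rpower (ln (INR q)) (2 - a) * dist_nint (INR q * alpha)
      * padic_abs p q * Rpower (ln (2 / padic_abs p q)) a).

(* Main.v *)
(** Write [q = p^k m] with [m] prime to [p]; the condition says that [alpha] avoids
    intervals of length about [c / (p^k m^2 (log q)^(2-a) (k+1)^a)] around the fractions
    [r / q]. The Peres-Schlag scheme removes these intervals in stages, [alpha] in [0, 1]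
    being localised in dyadic atoms of level [L_j = 4^j N0]: those with
    [2^(L_j) <= q < 2^(L_(j+1))] are removed at level [L_(j+2)]. Inside any surviving
    atom of level [L_j] the fractions of denominator [q] are evenly spread, so the stage
    removes a proportion [O(sum_q c / (m (log q)^(2-a) (k+1)^a)) = O(c)] of the set that
    survived stage [j]: the sum over [m] gives [L_j], the sum over [k] gives
    [L_j^(1-a)], and [log q] is of order [L_j]. Hence the surviving density decays at most
    like [2^-j].

    For the lower bound on the dimension, let [s < 1] and take a cover with
    [sum d_n^s <= 1]. Its members of diameter below [2^-(L_(j+1))] have total length at
    most [2^(-(1-s) L_(j+1))], negligible against [2^-j], so they can be removed along
    with the intervals above. The remaining point belongs to the set but not to the
    cover. *)
Require Import Defs.
From Stdlib Require Import Reals ZArith Znumtheory Lra Lia ClassicalEpsilon.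
Open Scope R_scope.


(** * Finite sums over initial segments of the naturals *)

(** The range is [i < n], unlike that of [sum_f_R0], so that the empty sum exists and ranges split
    cleanly into blocks. *)
Fixpoint sumn (f : nat -> R) (n : nat) : R :=
  match n with O => 0 | S m => sumn f m + f m end.

Lemma sum_f_R0_sumn f n : sum_f_R0 f n = sumn f (S n).
Proof. induction n as [|n IH]; simpl in *; [ring | rewrite IH; ring]. Qed.

Lemma sumn_le f g n :
  (forall i, (i < n)%nat -> f i <= g i) -> sumn f n <= sumn g n.
Proof.
  induction n as [|n IH]; intros H; simpl; [lra|].
  assert (f n <= g n) by (apply H; lia).
  assert (sumn f n <= sumn g n) by (apply IH; intros; apply H; lia). lra.
Qed.

Lemma sumn_ext f g n :
  (forall i, (i < n)%nat -> f i = g i) -> sumn f n = sumn g n.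
Proof.
  intros H; apply Rle_antisym; apply sumn_le; intros i Hi; rewrite (H i Hi); lra.
Qed.

Lemma sumn_plus f g n : sumn (fun i => f i + g i) n = sumn f n + sumn g n.
Proof. induction n as [|n IH]; simpl; [ring | rewrite IH; ring]. Qed.

Lemma sumn_scal c f n : sumn (fun i => c * f i) n = c * sumn f n.
Proof. induction n as [|n IH]; simpl; [ring | rewrite IH; ring]. Qed.

Lemma sumn_0 n : sumn (fun _ => 0) n = 0.
Proof. induction n as [|n IH]; simpl; [ring | rewrite IH; ring]. Qed.

Lemma sumn_nonneg f n : (forall i, (i < n)%nat -> 0 <= f i) -> 0 <= sumn f n.
Proof. intros H. rewrite <- (sumn_0 n). now apply sumn_le. Qed.

Lemma sumn_mono f m n :
  (forall i, 0 <= f i) -> (m <= n)%nat -> sumn f m <= sumn f n.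
Proof.
  intros Hf H; induction H as [|n H IH]; simpl; [lra|]. specialize (Hf n). lra.
Qed.

Lemma sumn_term_le f n i :
  (forall i, 0 <= f i) -> (i < n)%nat -> f i <= sumn f n.
Proof.
  intros Hf Hi. apply Rle_trans with (sumn f (S i)).
  - simpl. assert (0 <= sumn f i) by now apply sumn_nonneg. lra.
  - now apply sumn_mono.
Qed.

Lemma sumn_add f m n : sumn f (m + n) = sumn f m + sumn (fun i => f (m + i)%nat) n.
Proof.
  induction n as [|n IH]; simpl.
  - rewrite Nat.add_0_r. ring.
  - rewrite Nat.add_succ_r. simpl. rewrite IH. ring.
Qed.

Lemma sumn_exchange (f : nat -> nat -> R) m n :
  sumn (fun i => sumn (f i) n) m = sumn (fun k => sumn (fun i => f i k) m) n.
Proof.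
  induction m as [|m IH]; simpl.
  - now rewrite sumn_0.
  - rewrite IH. now rewrite <- sumn_plus.
Qed.

Lemma sumn_block f K D :
  sumn f (K * D) = sumn (fun J => sumn (fun i => f (J * D + i)%nat) D) K.
Proof.
  induction K as [|K IH]; [reflexivity|].
  replace (S K * D)%nat with (K * D + D)%nat by lia.
  rewrite sumn_add, IH. reflexivity.
Qed.

(** * Counting the indices that satisfy a predicate *)

(** Decided classically, since the predicates counted speak of real points and infinite unions. *)
Definition ind (P : nat -> Prop) (i : nat) : R :=
  if excluded_middle_informative (P i) then 1 else 0.

Definition cnt (P : nat -> Prop) (n : nat) : R := sumn (ind P) n.

Lemma ind_true (P : nat -> Prop) i : P i -> ind P i = 1.
Proof. intros H; unfold ind; destruct excluded_middle_informative; tauto. Qed.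

Lemma ind_false (P : nat -> Prop) i : ~ P i -> ind P i = 0.
Proof. intros H; unfold ind; destruct excluded_middle_informative; tauto. Qed.

Lemma ind_bounds P i : 0 <= ind P i <= 1.
Proof. unfold ind; destruct excluded_middle_informative; lra. Qed.

Lemma cnt_nonneg P n : 0 <= cnt P n.
Proof. apply sumn_nonneg; intros i _; apply ind_bounds. Qed.

Lemma cnt_cover (P Q R : nat -> Prop) n :
  (forall i, (i < n)%nat -> P i -> Q i \/ R i) -> cnt P n <= cnt Q n + cnt R n.
Proof.
  intros H. unfold cnt. rewrite <- sumn_plus. apply sumn_le. intros i Hi.
  pose proof (ind_bounds Q i). pose proof (ind_bounds R i).
  destruct (excluded_middle_informative (P i)) as [HP|HP].
  - rewrite (ind_true P) by assumption.
    destruct (H i Hi HP) as [HQ|HR];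
      [rewrite (ind_true Q) by assumption | rewrite (ind_true R) by assumption]; lra.
  - rewrite (ind_false P) by assumption. lra.
Qed.

Lemma cnt_false n : cnt (fun _ => False) n = 0.
Proof.
  unfold cnt. rewrite <- (sumn_0 n). apply sumn_ext.
  intros i _. now apply ind_false.
Qed.

Lemma cnt_sub (P Q : nat -> Prop) n :
  (forall i, (i < n)%nat -> P i -> Q i) -> cnt P n <= cnt Q n.
Proof.
  intros H. pose proof (cnt_cover P Q (fun _ => False) n) as C.
  rewrite cnt_false in C. rewrite <- (Rplus_0_r (cnt Q n)). apply C.
  intros i Hi HP; left; auto.
Qed.

Lemma cnt_pos (P : nat -> Prop) n : 0 < cnt P n -> exists i, (i < n)%nat /\ P i.
Proof.
  intros H. apply NNPP; intros N.
  assert (cnt P n <= cnt (fun _ => False) n).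
  { apply cnt_sub. intros i Hi HP. apply N. now exists i. }
  rewrite cnt_false in H0. lra.
Qed.

Lemma cnt_all n : cnt (fun _ => True) n = INR n.
Proof.
  induction n as [|n IH]; [reflexivity|].
  rewrite S_INR, <- IH. unfold cnt; simpl. rewrite (ind_true _ n I). reflexivity.
Qed.

Lemma cnt_interval (P : nat -> Prop) u v n :
  u <= v + 1 -> (forall i, P i -> u <= INR i <= v) -> cnt P n <= v - u + 1.
Proof.
  intros Huv H.
  (* The induction lets [v] vary: when [n] itself is counted, the other indices are at most [n - 1],
     which becomes the new right end. The hypothesis [u <= v + 1] is what remains true of it. *)
  assert (G : forall n v, u <= v + 1 ->
    (forall i, (i < n)%nat -> P i -> u <= INR i <= v) -> cnt P n <= v - u + 1).
  { clear v Huv H n. intros n. induction n as [|n IH]; intros v Huv H.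
    - unfold cnt; simpl; lra.
    - unfold cnt in *; simpl.
      destruct (excluded_middle_informative (P n)) as [HP|HP].
      + rewrite ind_true by assumption.
        destruct (H n (Nat.lt_succ_diag_r n) HP) as [H1 H2].
        assert (sumn (ind P) n <= (INR n - 1) - u + 1); [|lra].
        apply IH; [lra|]. intros i Hi HPi. split.
        * apply H; auto; lia.
        * apply lt_INR in Hi as Hi'. apply le_INR in Hi.
          rewrite S_INR in Hi. lra.
      + rewrite ind_false by assumption. rewrite Rplus_0_r.
        apply IH; [assumption|]. intros i Hi HPi. apply H; auto; lia. }
  apply G; auto.
Qed.

Lemma cnt_union (Q : nat -> nat -> Prop) F n :
  cnt (fun i => exists k, (k < F)%nat /\ Q k i) n <= sumn (fun k => cnt (Q k) n) F.
Proof.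
  induction F as [|F IH].
  - simpl. rewrite <- (cnt_false n). apply cnt_sub. intros i _ [k [Hk _]]. lia.
  - simpl. eapply Rle_trans; [|apply Rplus_le_compat_r, IH].
    apply cnt_cover. intros i _ [k [Hk HQ]].
    destruct (Nat.eq_dec k F) as [->|Hne]; [now right | left].
    exists k; split; [lia | assumption].
Qed.

(** Only the finitely many [i < n] matter, and one witness [k] for each suffices, so the union may
    be truncated at some [F]. *)
Lemma cnt_union_infinite (Q : nat -> nat -> Prop) n M :
  (forall F, sumn (fun k => cnt (Q k) n) F <= M) ->
  cnt (fun i => exists k, Q k i) n <= M.
Proof.
  intros H.
  assert (W : exists F, forall i, (i < n)%nat -> (exists k, Q k i) ->
                exists k, (k < F)%nat /\ Q k i).
  { clear H. induction n as [|n [F IH]]; [exists O; intros; lia|].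
    destruct (excluded_middle_informative (exists k, Q k n)) as [[k Hk]|N].
    - exists (Nat.max F (S k)). intros i Hi Hex.
      destruct (Nat.eq_dec i n) as [->|Hne].
      + exists k; split; [lia | assumption].
      + destruct (IH i) as [k' [H1 H2]]; [lia | assumption |].
        exists k'; split; [lia | assumption].
    - exists F. intros i Hi Hex. apply IH; [|assumption].
      assert (i <> n) by (intros ->; contradiction). lia. }
  destruct W as [F W].
  apply Rle_trans with (cnt (fun i => exists k, (k < F)%nat /\ Q k i) n).
  - now apply cnt_sub.
  - eapply Rle_trans; [apply cnt_union | apply H].
Qed.

Lemma cnt_union_uniform (S : nat -> Prop) (Q : nat -> nat -> Prop) F n B :
  (forall k, S k -> cnt (Q k) n <= B) ->
  cnt (fun i => exists k, (k < F)%nat /\ S k /\ Q k i) n <= B * cnt S F.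
Proof.
  intros H. eapply Rle_trans; [apply (cnt_union (fun k i => S k /\ Q k i))|].
  unfold cnt at 2. rewrite <- sumn_scal. apply sumn_le. intros k _.
  destruct (excluded_middle_informative (S k)) as [HS|HS].
  - rewrite ind_true, Rmult_1_r by assumption.
    eapply Rle_trans; [|apply (H k HS)]. apply cnt_sub. tauto.
  - rewrite ind_false, Rmult_0_r by assumption.
    rewrite <- (cnt_false n). apply cnt_sub. tauto.
Qed.

Lemma div_block J D i : (i < D)%nat -> ((J * D + i) / D = J)%nat.
Proof.
  intros H. rewrite Nat.add_comm, Nat.div_add by lia. rewrite Nat.div_small; lia.
Qed.

(** [i / D] is the index of the coarse atom containing the fine atom [i]. The fine indices are
    grouped by parent, and parents outside [P] contribute nothing. *)
Lemma cnt_parent_and (P Q : nat -> Prop) K D B :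
  (forall J, P J -> cnt (fun i => Q (J * D + i)%nat) D <= B) ->
  cnt (fun i => P (i / D)%nat /\ Q i) (K * D) <= B * cnt P K.
Proof.
  intros H. unfold cnt at 1. rewrite sumn_block.
  unfold cnt. rewrite <- sumn_scal. apply sumn_le. intros J _.
  destruct (excluded_middle_informative (P J)) as [HP|HP].
  - rewrite (ind_true P), Rmult_1_r by assumption.
    eapply Rle_trans; [|apply (H J HP)]. apply sumn_le. intros i Hi.
    unfold ind. do 2 destruct excluded_middle_informative; try lra. tauto.
  - rewrite (ind_false P), Rmult_0_r by assumption.
    rewrite <- (sumn_0 D). apply sumn_le. intros i Hi.
    rewrite ind_false; [lra|]. rewrite div_block by assumption. tauto.
Qed.

Lemma cnt_parent (P : nat -> Prop) K D :
  cnt (fun i => P (i / D)%nat) (K * D) = INR D * cnt P K.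
Proof.
  unfold cnt. rewrite sumn_block, <- sumn_scal. apply sumn_ext. intros J _.
  transitivity (sumn (fun _ => ind P J) D).
  - apply sumn_ext. intros i Hi. unfold ind. rewrite div_block by assumption.
    reflexivity.
  - generalize (ind P J); intros t. clear. induction D as [|D IH].
    + simpl; ring.
    + rewrite S_INR. simpl sumn. rewrite IH. ring.
Qed.


(** * Dyadic atoms, the removal scheme and its limit point *)

(** Atoms are closed, so neighbours share an endpoint; the limit argument relies on this when the
    limit falls on the grid. *)
Definition atom (N i : nat) (x : R) : Prop := INR i <= x * 2 ^ N <= INR i + 1.

Lemma pow2_pos n : 0 < 2 ^ n.
Proof. apply pow_lt; lra. Qed.

Lemma INR_pow2 n : INR (2 ^ n) = 2 ^ n.
Proof. rewrite pow_INR. reflexivity. Qed.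

(** An atom that merely meets the bad set of its stage is discarded whole, so no point of a
    surviving atom, endpoints included, is bad at that stage. *)
Fixpoint survivors (lev : nat -> nat) (B : nat -> R -> Prop) (j i : nat) : Prop :=
  match j with
  | O => True
  | S k => survivors lev B k (i / 2 ^ (lev (S k) - lev k))%nat
           /\ forall x, atom (lev (S k)) i x -> ~ B (S k) x
  end.

(** Iterated integer division leads from [i] to its ancestor [m]. The real inequalities say that the
    left end of atom [i] lies in the half-open atom [m], which is the form used to compare positions
    across levels. *)
Lemma survivors_ancestor lev B j k i :
  (forall n, (lev n <= lev (S n))%nat) -> (j <= k)%nat -> survivors lev B k i ->
  exists m, survivors lev B j m /\
    INR m <= INR i / 2 ^ lev k * 2 ^ lev j < INR m + 1.
Proof.
  intros Hlev Hjk. revert i. induction Hjk as [|k Hjk IH]; intros i Hi.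
  - exists i. split; [assumption|]. pose proof (pow2_pos (lev j)).
    replace (INR i / 2 ^ lev j * 2 ^ lev j) with (INR i) by (field; lra). lra.
  - destruct Hi as [Hi _]. destruct (IH _ Hi) as [m [Hm Hb]].
    exists m; split; [assumption|].
    assert (Hle : (lev j <= lev k)%nat).
    { clear -Hlev Hjk. induction Hjk; [lia|]. specialize (Hlev m). lia. }
    set (D := (2 ^ (lev (S k) - lev k))%nat) in *.
    set (E := (2 ^ (lev k - lev j))%nat).
    assert (HD : (0 < D)%nat) by (apply Nat.neq_0_lt_0, Nat.pow_nonzero; lia).
    assert (HDR : 2 ^ lev (S k) = 2 ^ lev k * INR D).
    { unfold D. rewrite INR_pow2, <- pow_add. f_equal. specialize (Hlev k). lia. }
    assert (HER : 2 ^ lev k = 2 ^ lev j * INR E).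
    { unfold E. rewrite INR_pow2, <- pow_add. f_equal. lia. }
    pose proof (Nat.div_mod_eq i D) as Hdm.
    pose proof (Nat.mod_upper_bound i D ltac:(lia)) as Hmod.
    set (i' := (i / D)%nat) in *.
    pose proof (pow2_pos (lev j)) as Pj.
    assert (PE : 0 < INR E) by (unfold E; rewrite INR_pow2; apply pow2_pos).
    assert (PD : 0 < INR D) by (unfold D; rewrite INR_pow2; apply pow2_pos).
    assert (Hb' : INR m * INR E <= INR i' < (INR m + 1) * INR E).
    { rewrite HER in Hb.
      replace (INR i' / (2 ^ lev j * INR E) * 2 ^ lev j) with (INR i' / INR E) in Hb
        by (field; lra).
      destruct Hb as [B1 B2]. split.
      - apply Rmult_le_compat_r with (r := INR E) in B1; [|lra].
        replace (INR i' / INR E * INR E) with (INR i') in B1 by (field; lra). lra.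
      - apply Rmult_lt_compat_r with (r := INR E) in B2; [|lra].
        replace (INR i' / INR E * INR E) with (INR i') in B2 by (field; lra). lra. }
    (* Integrality absorbs the rounding in [i / D]: from [i' < S m * E] follows [S i' <= S m * E],
       hence [i < S i' * D <= S m * E * D]. *)
    assert (Hn1 : (m * E <= i')%nat) by (apply INR_le; rewrite mult_INR; lra).
    assert (Hn2 : (i' < S m * E)%nat)
      by (apply INR_lt; rewrite mult_INR, S_INR; lra).
    assert (Hm1 : (m * E * D <= i)%nat) by nia.
    assert (Hm2 : (i < S m * E * D)%nat) by nia.
    apply le_INR in Hm1. apply lt_INR in Hm2.
    rewrite !mult_INR in Hm1, Hm2. rewrite S_INR in Hm2.
    assert (PED : 0 < INR E * INR D) by nra.
    replace (INR i / 2 ^ lev (S k) * 2 ^ lev j) with (INR i / (INR E * INR D))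
      by (rewrite HDR, HER; field; lra).
    split.
    + apply Rmult_le_reg_r with (INR E * INR D); [assumption|].
      replace (INR i / (INR E * INR D) * (INR E * INR D)) with (INR i) by (field; lra).
      lra.
    + apply Rmult_lt_reg_r with (INR E * INR D); [assumption|].
      replace (INR i / (INR E * INR D) * (INR E * INR D)) with (INR i) by (field; lra).
      lra.
Qed.

Lemma INR_lt_IZR_step m z : INR m < IZR z -> INR m + 1 <= IZR z.
Proof.
  rewrite INR_IZR_INZ. intros H. apply lt_IZR in H.
  rewrite <- plus_IZR. apply IZR_le. lia.
Qed.

Lemma IZR_lt_INR_step z m : IZR z < INR m -> IZR z + 1 <= INR m.
Proof.
  rewrite INR_IZR_INZ. intros H. apply lt_IZR in H.
  rewrite <- plus_IZR. apply IZR_le. lia.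
Qed.

(* The limit point is the supremum of the lower bounds of the stages. *)
Lemma survivors_limit lev B :
  (forall n, (lev n <= lev (S n))%nat) ->
  (forall j, exists i, (i < 2 ^ lev j)%nat /\ survivors lev B j i) ->
  exists x, forall j, exists m, survivors lev B j m /\ atom (lev j) m x.
Proof.
  intros Hlev Hne.
  set (Low := fun y => exists j, forall i, survivors lev B j i -> y <= INR i / 2 ^ lev j).
  destruct (completeness Low) as [x [Hub Hlub]].
  - exists 1. intros y [j Hy]. destruct (Hne j) as [i [Hi Hs]].
    specialize (Hy i Hs). pose proof (pow2_pos (lev j)).
    apply lt_INR in Hi. rewrite INR_pow2 in Hi.
    apply Rle_trans with (1 := Hy).
    apply Rmult_le_reg_r with (2 ^ lev j); [assumption|].
    replace (INR i / 2 ^ lev j * 2 ^ lev j) with (INR i) by (field; lra). lra.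
  - exists 0, O. intros i _. apply Rmult_le_pos; [apply pos_INR|].
    left; apply Rinv_0_lt_compat, pow2_pos.
  - exists x. intros j. apply NNPP; intros Nx.
    pose proof (pow2_pos (lev j)) as Pj.
    set (t := x * 2 ^ lev j).
    (* [v] and [- IZR w] are the nearest integers strictly above and strictly below [t]. If no
       surviving atom of stage [j] contains [x], no later survivor has its left end strictly between
       them. *)
    destruct (archimed t) as [A1 A2]. destruct (archimed (- t)) as [A3 A4].
    set (v := IZR (up t)) in *. set (w := up (- t)) in *.
    assert (Hgap : forall k i, (j <= k)%nat -> survivors lev B k i ->
      INR i / 2 ^ lev k * 2 ^ lev j <= - IZR w \/ v <= INR i / 2 ^ lev k * 2 ^ lev j).
    { intros k i Hk Hs.
      destruct (survivors_ancestor lev B j k i Hlev Hk Hs) as [m [Hm Hb]].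
      set (z := INR i / 2 ^ lev k * 2 ^ lev j) in *.
      destruct (Rle_lt_dec z (- IZR w)) as [|Hz1]; [now left|].
      destruct (Rle_lt_dec v z) as [|Hz2]; [now right|].
      exfalso. apply Nx. exists m; split; [assumption|]. unfold atom. fold t.
      assert (INR m + 1 <= v) by (apply INR_lt_IZR_step; fold v; lra).
      assert (IZR (- w) + 1 <= INR (S m))
        by (apply IZR_lt_INR_step; rewrite S_INR, opp_IZR; lra).
      rewrite S_INR, opp_IZR in *. lra. }
    (* As [- IZR w < t], a supremum property places some stage bound [y] past the lower edge of the
       gap. *)
    assert (Hy : exists y, Low y /\ - IZR w < y * 2 ^ lev j).
    { apply NNPP; intros Ny.
      assert (x <= - IZR w / 2 ^ lev j).
      { apply Hlub. intros y Ly. apply Rmult_le_reg_r with (2 ^ lev j); [assumption|].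
        replace (- IZR w / 2 ^ lev j * 2 ^ lev j) with (- IZR w) by (field; lra).
        destruct (Rle_lt_dec (y * 2 ^ lev j) (- IZR w)); [assumption|].
        exfalso. apply Ny. now exists y. }
      apply Rmult_le_compat_r with (r := 2 ^ lev j) in H; [|lra].
      replace (- IZR w / 2 ^ lev j * 2 ^ lev j) with (- IZR w) in H by (field; lra).
      fold t in H. lra. }
    destruct Hy as [y [[k Lk] Hy]].
    (* From stage [max j k] on, all left ends are at least [y], so they jump over the gap; then
       [v / 2 ^ lev j] is itself a stage bound, yet it exceeds the supremum [x]. *)
    assert (Hv : Low (v / 2 ^ lev j)).
    { exists (Nat.max j k). intros i Hs.
      destruct (survivors_ancestor lev B k _ i Hlev (Nat.le_max_r j k) Hs) as [m [Hm Hb]].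
      specialize (Lk m Hm). set (z := INR i / 2 ^ lev (Nat.max j k)) in *.
      assert (y <= z).
      { apply Rle_trans with (1 := Lk). pose proof (pow2_pos (lev k)).
        apply Rmult_le_reg_r with (2 ^ lev k); [assumption|].
        replace (INR m / 2 ^ lev k * 2 ^ lev k) with (INR m) by (field; lra). lra. }
      assert (y * 2 ^ lev j <= z * 2 ^ lev j) by (apply Rmult_le_compat_r; lra).
      destruct (Hgap _ i (Nat.le_max_l j k) Hs) as [G|G]; fold z in G; [lra|].
      apply Rmult_le_reg_r with (2 ^ lev j); [assumption|].
      replace (v / 2 ^ lev j * 2 ^ lev j) with v by (field; lra). lra. }
    apply Hub in Hv. apply Rmult_le_compat_r with (r := 2 ^ lev j) in Hv; [|lra].
    replace (v / 2 ^ lev j * 2 ^ lev j) with v in Hv by (field; lra).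
    fold t in Hv. lra.
Qed.

(** * Counting the atoms met by neighbourhoods of fractions and by cover members *)

Definition near (psi : nat -> R) (q : nat) (x : R) : Prop :=
  exists r : Z, Rabs (INR q * x - IZR r) < psi q.

(* A block of [2^e] atoms of level [n + e] has length [2^-n >= 1 / q], so it is
   close to at most [3 q / 2^n] fractions of denominator [q]. *)
Lemma cnt_near_block psi n e q J :
  2 ^ n <= INR q -> psi q <= / 2 -> INR q <= psi q * 2 ^ (n + e) ->
  cnt (fun i => exists x, atom (n + e) (J * 2 ^ e + i) x /\ near psi q x) (2 ^ e)
    <= 12 * psi q * 2 ^ e.
Proof.
  intros Hq Hpsi Hlow.
  pose proof (pow2_pos n) as Pn. pose proof (pow2_pos e) as Pe.
  rewrite pow_add in Hlow.
  set (N := 2 ^ n * 2 ^ e) in *.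
  assert (PN : 0 < N) by (unfold N; nra).
  assert (Pq : 0 < INR q) by lra.
  assert (Ppsi : 0 < psi q) by nra.
  (* [Rg] holds the numerators whose neighbourhood can reach the block, the margin [1/2] coming from
     [psi q <= / 2]; [Q r] holds the offsets of the atoms meeting the neighbourhood of [r / q]. *)
  set (Rg := fun r => INR q * INR J / 2 ^ n - / 2 <= INR r
                      <= INR q * (INR J + 1) / 2 ^ n + / 2).
  set (Q := fun r i => (INR r - psi q) / INR q * N - 1 - INR J * 2 ^ e <= INR i
                       <= (INR r + psi q) / INR q * N - INR J * 2 ^ e).
  destruct (INR_archimed 1 (INR q * (INR J + 1) / 2 ^ n + / 2) Rlt_0_1) as [F HF].
  apply Rle_trans with (4 * psi q / INR q * N * cnt Rg F).
  - eapply Rle_trans; [|apply cnt_union_uniform with (Q := Q)].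
    + apply cnt_sub. intros i Hi [x [Hx [r Hr]]].
      unfold atom in Hx. rewrite pow_add in Hx. fold N in Hx.
      rewrite plus_INR, mult_INR, INR_pow2 in Hx.
      apply Rabs_def2 in Hr.
      apply lt_INR in Hi as Hi1. rewrite INR_pow2 in Hi1.
      assert (Hi2 : INR i + 1 <= 2 ^ e).
      { apply le_INR in Hi. rewrite S_INR, INR_pow2 in Hi. lra. }
      pose proof (pos_INR i) as Pi. pose proof (pos_INR J) as PJ.
      assert (X1 : INR J / 2 ^ n <= x).
      { apply Rmult_le_reg_r with N; [assumption|].
        replace (INR J / 2 ^ n * N) with (INR J * 2 ^ e) by (unfold N; field; lra).
        lra. }
      assert (X2 : x <= (INR J + 1) / 2 ^ n).
      { apply Rmult_le_reg_r with N; [assumption|].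
        replace ((INR J + 1) / 2 ^ n * N) with ((INR J + 1) * 2 ^ e)
          by (unfold N; field; lra). lra. }
      assert (X0 : 0 <= x).
      { apply Rle_trans with (2 := X1). apply Rmult_le_pos; [assumption|].
        left; now apply Rinv_0_lt_compat. }
      assert (Y1 : INR q * INR J / 2 ^ n <= INR q * x).
      { unfold Rdiv in *. rewrite Rmult_assoc. apply Rmult_le_compat_l; lra. }
      assert (Y2 : INR q * x <= INR q * (INR J + 1) / 2 ^ n).
      { unfold Rdiv in *. rewrite Rmult_assoc. apply Rmult_le_compat_l; lra. }
      assert (Hr0 : (0 <= r)%Z).
      { assert (0 <= INR q * x) by nra.
        assert (IZR (-1) < IZR r) by lra. apply lt_IZR in H0. lia. }
      exists (Z.to_nat r).
      assert (Er : INR (Z.to_nat r) = IZR r) by (rewrite INR_IZR_INZ, Z2Nat.id; auto).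
      split; [|split].
      * apply INR_lt. rewrite Er. lra.
      * unfold Rg. rewrite Er. lra.
      * unfold Q. rewrite Er.
        assert (Z1 : (IZR r - psi q) / INR q <= x).
        { apply Rmult_le_reg_r with (INR q); [assumption|].
          replace ((IZR r - psi q) / INR q * INR q) with (IZR r - psi q) by (field; lra).
          lra. }
        assert (Z2 : x <= (IZR r + psi q) / INR q).
        { apply Rmult_le_reg_r with (INR q); [assumption|].
          replace ((IZR r + psi q) / INR q * INR q) with (IZR r + psi q) by (field; lra).
          lra. }
        apply Rmult_le_compat_r with (r := N) in Z1; [|lra].
        apply Rmult_le_compat_r with (r := N) in Z2; [|lra]. lra.
    + intros r _.
      (* The half-width [psi q / q] is at least [t = 1] atom length, so the rounding term is
         absorbed: [2 t + 2 <= 4 t], where [t] is the half-width in atoms. *)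
      assert (E1 : 1 <= psi q / INR q * N).
      { apply Rmult_le_reg_r with (INR q); [assumption|].
        replace (psi q / INR q * N * INR q) with (psi q * N) by (field; lra). lra. }
      assert (E2 : (INR r + psi q) / INR q * N - (INR r - psi q) / INR q * N
                   = 2 * (psi q / INR q * N)) by (field; lra).
      eapply Rle_trans; [apply cnt_interval; [|intros i Hi; exact Hi]; lra|].
      replace (4 * psi q / INR q * N) with (4 * (psi q / INR q * N)) by (field; lra).
      lra.
  (* There are at most [q / 2^n + 2 <= 3 q / 2^n] numerators because [2^n <= q]. Together with the
     factor 4 per numerator this gives 12. *)
  - assert (HR : cnt Rg F <= 3 * (INR q / 2 ^ n)).
    { assert (1 <= INR q / 2 ^ n).
      { apply Rmult_le_reg_r with (2 ^ n); [assumption|].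
        replace (INR q / 2 ^ n * 2 ^ n) with (INR q) by (field; lra). lra. }
      assert (INR q * (INR J + 1) / 2 ^ n = INR q * INR J / 2 ^ n + INR q / 2 ^ n)
        by (field; lra).
      eapply Rle_trans; [apply cnt_interval; [|intros r Hr; exact Hr]; lra|]. lra. }
    assert (P4 : 0 <= 4 * psi q / INR q * N).
    { apply Rmult_le_pos; [|lra]. apply Rmult_le_pos; [lra|].
      left; now apply Rinv_0_lt_compat. }
    apply Rle_trans with (4 * psi q / INR q * N * (3 * (INR q / 2 ^ n))).
    + now apply Rmult_le_compat_l.
    + unfold N. right. field. lra.
Qed.

(** Cutting off below [Q] writes a sum over [Q <= q < n] as an initial sum. *)
Definition tail (Q : nat) (psi : nat -> R) (q : nat) : R :=
  if (Q <=? q)%nat then psi q else 0.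

(** The block bound holds inside every atom of level [n], hence inside those of [P] alone. The loss
    is thus proportional to [cnt P], whatever the structure of [P]. *)
Lemma cnt_near psi (P : nat -> Prop) n e Q1 Q2 :
  (2 ^ n <= Q1)%nat ->
  (forall q, (Q1 <= q < Q2)%nat -> psi q <= / 2 /\ INR q <= psi q * 2 ^ (n + e)) ->
  cnt (fun i => P (i / 2 ^ e)%nat /\
         exists q, (Q1 <= q < Q2)%nat /\ exists x, atom (n + e) i x /\ near psi q x)
      (2 ^ n * 2 ^ e)
    <= 12 * sumn (tail Q1 psi) Q2 * 2 ^ e * cnt P (2 ^ n).
Proof.
  intros HQ Hpsi. set (X := fun i q => exists x, atom (n + e) i x /\ near psi q x).
  eapply Rle_trans; [|eapply Rle_trans;
    [apply (cnt_union (fun q i => P (i / 2 ^ e)%nat /\ ((Q1 <= q)%nat /\ X i q)) Q2)|]].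
  - apply cnt_sub. intros i _ [HP [q [Hq HX]]]. exists q. split; [lia|].
    split; [assumption|]. split; [lia | assumption].
  - apply Rle_trans with
      (sumn (fun q => (12 * 2 ^ e * cnt P (2 ^ n)) * tail Q1 psi q) Q2);
      [|rewrite sumn_scal; right; ring].
    apply sumn_le. intros q Hq. unfold tail. destruct (Nat.leb_spec Q1 q) as [H1|H1].
    + apply Rle_trans with (12 * psi q * 2 ^ e * cnt P (2 ^ n)); [|right; ring].
      apply cnt_parent_and. intros J _.
      destruct (Hpsi q (conj H1 Hq)) as [Ha Hb].
      eapply Rle_trans; [|apply cnt_near_block; try eassumption].
      * apply cnt_sub. intros i _ [_ HX]. exact HX.
      * rewrite <- INR_pow2. apply le_INR. lia.
    + rewrite Rmult_0_r, <- (cnt_false (2 ^ n * 2 ^ e)). apply cnt_sub.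
      intros i _ [_ [H2 _]]. lia.
Qed.

(** [V] lies within [d] of any of its points, so it meets at most [2 d 2^N + 2] atoms, and
    [1 <= d 2^N] absorbs the 2. *)
Lemma cnt_meets (V : R -> Prop) d N n :
  1 <= d * 2 ^ N -> (forall x y, V x -> V y -> Rabs (x - y) <= d) ->
  cnt (fun i => exists x, atom N i x /\ V x) n <= 4 * d * 2 ^ N.
Proof.
  intros Hd Hdiam. pose proof (pow2_pos N) as PN.
  destruct (excluded_middle_informative (exists x, V x)) as [[x0 H0]|Ne].
  - eapply Rle_trans;
      [apply cnt_interval with (u := (x0 - d) * 2 ^ N - 1) (v := (x0 + d) * 2 ^ N)|];
      [nra| |nra].
    intros i [x [Hx HV]]. specialize (Hdiam x x0 HV H0). unfold atom in Hx.
    assert (- d <= x - x0 <= d).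
    { unfold Rabs in Hdiam. destruct (Rcase_abs (x - x0)); lra. }
    split; nra.
  - eapply Rle_trans; [|apply Rle_trans with 0; [right; apply (cnt_false n)|nra]].
    apply cnt_sub. intros i _ [x [_ HV]]. apply Ne. now exists x.
Qed.

Lemma Rpower_mono_base x y z : 0 < x -> x <= y -> 0 <= z -> Rpower x z <= Rpower y z.
Proof. intros. apply Rle_Rpower_l; lra. Qed.

(** For members with [d k < 2^-N1], write [d k = (d k)^s (d k)^(1-s)] and bound the second factor by
    [2^(-(1-s) N1)]; the first factors sum to at most 1. *)
Lemma cnt_small_cover (U : nat -> R -> Prop) d s N1 N2 n :
  0 < s < 1 -> (forall k, 0 < d k) ->
  (forall k x y, U k x -> U k y -> Rabs (x - y) <= d k) ->
  (forall F, sumn (fun k => Rpower (d k) s) F <= 1) ->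
  cnt (fun i => exists k, (1 <= d k * 2 ^ N2 /\ d k * 2 ^ N1 < 1)
                 /\ exists x, atom N2 i x /\ U k x) n
    <= 4 * Rpower 2 (- ((1 - s) * INR N1)) * 2 ^ N2.
Proof.
  intros Hs Hd Hdiam Hsum.
  pose proof (pow2_pos N1) as P1. pose proof (pow2_pos N2) as P2.
  set (C := 4 * Rpower 2 (- ((1 - s) * INR N1)) * 2 ^ N2).
  assert (PC : 0 <= C).
  { unfold C. apply Rmult_le_pos; [|lra]. apply Rmult_le_pos; [lra|].
    left; apply exp_pos. }
  apply cnt_union_infinite. intros F.
  apply Rle_trans with (sumn (fun k => C * Rpower (d k) s) F).
  2: { rewrite sumn_scal. specialize (Hsum F). nra. }
  apply sumn_le. intros k _.
  assert (Pk : 0 < Rpower (d k) s) by apply exp_pos.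
  destruct (excluded_middle_informative (1 <= d k * 2 ^ N2 /\ d k * 2 ^ N1 < 1))
    as [[H2 H1]|Hn].
  - apply Rle_trans with (4 * d k * 2 ^ N2).
    + eapply Rle_trans; [|apply cnt_meets; [exact H2 | apply (Hdiam k)]].
      apply cnt_sub. tauto.
    + assert (E : d k = Rpower (d k) s * Rpower (d k) (1 - s)).
      { rewrite <- Rpower_plus. replace (s + (1 - s)) with 1 by ring.
        rewrite Rpower_1; auto. }
      assert (L : Rpower (d k) (1 - s) <= Rpower 2 (- ((1 - s) * INR N1))).
      { replace (- ((1 - s) * INR N1)) with (- INR N1 * (1 - s)) by ring.
        rewrite <- Rpower_mult. apply Rpower_mono_base; [apply Hd | | lra].
        rewrite Rpower_Ropp, Rpower_pow by lra.
        apply Rmult_le_reg_r with (2 ^ N1); [assumption|].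
        rewrite Rinv_l by lra. lra. }
      apply Rmult_le_compat_l with (r := Rpower (d k) s) in L; [|lra].
      rewrite <- E in L. unfold C.
      replace (4 * Rpower 2 (- ((1 - s) * INR N1)) * 2 ^ N2 * Rpower (d k) s) with
        (4 * (Rpower (d k) s * Rpower 2 (- ((1 - s) * INR N1))) * 2 ^ N2) by ring.
      apply Rmult_le_compat_r; lra.
  - apply Rle_trans with 0; [|nra].
    rewrite <- (cnt_false n). apply cnt_sub. tauto.
Qed.


(** * The stages of the scheme and the decay of the surviving density *)

(** The ratio 4 ensures [q^4 <= 2^(lev (j+2))] for [q < 2^(lev (j+1))], so that [psi q >= q^-3]
    makes [psi q / q] at least an atom length. *)
Definition lev (N0 j : nat) : nat := (N0 * 4 ^ j)%nat.

Lemma lev_S N0 j : lev N0 (S j) = (4 * lev N0 j)%nat.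
Proof. unfold lev. simpl. lia. Qed.

Lemma lev_ge N0 j : (N0 * S j <= lev N0 j)%nat.
Proof.
  unfold lev. apply Nat.mul_le_mono_l.
  induction j as [|j IH]; simpl in *; lia.
Qed.

Lemma nat_crossing (P : nat -> Prop) n :
  ~ P O -> P n -> exists j, ~ P j /\ P (S j).
Proof.
  intros H0. induction n as [|n IH]; intros Hn; [contradiction|].
  destruct (excluded_middle_informative (P n)); [auto | now exists n].
Qed.

(** Stages 0 and 1 remove nothing. A cover member is removed at the stage where it is at least one
    new atom long but shorter than the atoms of the previous stage. *)
Definition bad (N0 : nat) (psi : nat -> R) (U : nat -> R -> Prop) (d : nat -> R)
    (j : nat) (x : R) : Prop :=
  match j with
  | S (S k) =>
      (exists q, (2 ^ lev N0 k <= q < 2 ^ lev N0 (S k))%nat /\ near psi q x)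
      \/ (exists n, (1 <= d n * 2 ^ lev N0 (S (S k)) /\ d n * 2 ^ lev N0 (S k) < 1)
                    /\ U n x)
  | _ => False
  end.

Definition density (lv : nat -> nat) (B : nat -> R -> Prop) (j : nat) : R :=
  cnt (survivors lv B j) (2 ^ lv j) / 2 ^ lv j.

Lemma density_trivial_step lv B j :
  (lv j <= lv (S j))%nat -> (forall x, ~ B (S j) x) ->
  density lv B (S j) = density lv B j.
Proof.
  intros Hlv HB. unfold density.
  set (D := (2 ^ (lv (S j) - lv j))%nat).
  assert (HD : (2 ^ lv (S j) = 2 ^ lv j * D)%nat).
  { unfold D. rewrite <- Nat.pow_add_r. f_equal. lia. }
  assert (E : cnt (survivors lv B (S j)) (2 ^ lv (S j))
              = INR D * cnt (survivors lv B j) (2 ^ lv j)).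
  { rewrite <- cnt_parent, <- HD. apply Rle_antisym; apply cnt_sub; intros i _ H.
    - exact (proj1 H).
    - split; [exact H | intros x _; apply HB]. }
  rewrite E, <- (INR_pow2 (lv (S j))), HD, mult_INR, INR_pow2.
  pose proof (pow2_pos (lv j)).
  assert (0 < INR D) by (unfold D; rewrite INR_pow2; apply pow2_pos).
  field. lra.
Qed.

(* The fractions of denominator [q] in the range of stage [j + 2] are spread evenly over
   every interval of stage [j]; what happened at stage [j + 1] is irrelevant to them. *)
Lemma density_step N0 psi U d s j :
  0 < s < 1 ->
  (forall q, (2 ^ N0 <= q)%nat -> psi q <= / 2 /\ 1 <= psi q * INR q ^ 3) ->
  (forall N, (N0 <= N)%nat -> sumn (tail (2 ^ N) psi) (2 ^ (4 * N)) <= / 96) ->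
  (forall k, 0 < d k) ->
  (forall k x y, U k x -> U k y -> Rabs (x - y) <= d k) ->
  (forall F, sumn (fun k => Rpower (d k) s) F <= 1) ->
  let b := density (lev N0) (bad N0 psi U d) in
  b (S j) - / 8 * b j - 4 * Rpower 2 (- ((1 - s) * INR (lev N0 (S j)))) <= b (S (S j)).
Proof.
  intros Hs Hpsi Hsum Hd Hdiam Hds b. unfold b, density. clear b.
  set (B := bad N0 psi U d).
  set (A := survivors (lev N0) B).
  set (l0 := lev N0 j). set (l1 := lev N0 (S j)). set (l2 := lev N0 (S (S j))).
  assert (E1 : l1 = (4 * l0)%nat) by apply lev_S.
  assert (E2 : l2 = (4 * l1)%nat) by apply lev_S.
  assert (HN0 : (N0 <= l0)%nat) by (pose proof (lev_ge N0 j); unfold l0; nia).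
  set (D := (2 ^ (l2 - l1))%nat). set (e := (l2 - l0)%nat).
  assert (HD : (2 ^ l2 = 2 ^ l1 * D)%nat).
  { unfold D. rewrite <- Nat.pow_add_r. f_equal. lia. }
  assert (He : (2 ^ l2 = 2 ^ l0 * 2 ^ e)%nat).
  { unfold e. rewrite <- Nat.pow_add_r. f_equal. lia. }
  assert (Hl : l2 = (l0 + e)%nat) by (unfold e; lia).
  (* [R1] remembers only that the ancestor two stages up survived, which suffices for an upper
     bound; [R2] collects the losses to the cover. *)
  set (R1 := fun i => A j (i / 2 ^ e)%nat /\ exists q, (2 ^ l0 <= q < 2 ^ l1)%nat /\
               exists x, atom (l0 + e) i x /\ near psi q x).
  set (R2 := fun i => exists k, (1 <= d k * 2 ^ l2 /\ d k * 2 ^ l1 < 1)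
                 /\ exists x, atom l2 i x /\ U k x).
  assert (C0 : cnt (fun i => A (S j) (i / D)%nat) (2 ^ l1 * D)
               <= cnt (A (S (S j))) (2 ^ l2) + (cnt R1 (2 ^ l2) + cnt R2 (2 ^ l2))).
  { rewrite <- HD.
    eapply Rle_trans; [apply cnt_cover with (Q := A (S (S j))) (R := fun i => R1 i \/ R2 i)
                      | apply Rplus_le_compat_l, cnt_cover; auto].
    intros i _ Hi.
    destruct (excluded_middle_informative (R1 i \/ R2 i)) as [|Hn]; [now right|left].
    split; [exact Hi|]. intros x Hx [[q [Hq Hnear]]|[k [Hk HU]]]; apply Hn.
    - left. split.
      + destruct Hi as [Hi _]. fold l0 l1 A in Hi.
        rewrite Nat.Div0.div_div in Hi. unfold D in Hi.
        rewrite <- Nat.pow_add_r in Hi.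
        replace (l2 - l1 + (l1 - l0))%nat with e in Hi by (unfold e; lia). exact Hi.
      + exists q. split; [exact Hq|]. exists x. rewrite <- Hl. split; assumption.
    - right. exists k. split; [exact Hk|]. exists x; split; assumption. }
  rewrite cnt_parent in C0.
  (* The constant [/ 96] in the hypothesis is chosen so that the lost proportion is
     [12 / 96 = 1 / 8]. *)
  assert (C1 : cnt R1 (2 ^ l2) <= 12 * / 96 * 2 ^ e * cnt (A j) (2 ^ l0)).
  { rewrite He. eapply Rle_trans; [apply cnt_near; [lia|]|].
    - intros q Hq. destruct (Hpsi q) as [H1 H2].
      { apply Nat.le_trans with (2 ^ l0)%nat; [|lia]. apply Nat.pow_le_mono_r; lia. }
      split; [assumption|]. rewrite <- Hl.
      assert (Q1 : INR q ^ 4 <= 2 ^ l2).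
      { rewrite E2, Nat.mul_comm, pow_mult. apply pow_incr. split; [apply pos_INR|].
        rewrite <- INR_pow2. apply le_INR. lia. }
      assert (Q0 : 1 <= INR q).
      { replace 1 with (INR 1) by reflexivity. apply le_INR.
        assert (2 ^ l0 <> 0)%nat by (apply Nat.pow_nonzero; lia). lia. }
      assert (Q3 : 0 < INR q ^ 3) by (apply pow_lt; lra).
      assert (Pp : 0 < psi q) by nra.
      apply Rle_trans with (psi q * INR q ^ 4); [|apply Rmult_le_compat_l; lra].
      replace (psi q * INR q ^ 4) with (INR q * (psi q * INR q ^ 3)) by ring. nra.
    - assert (0 <= 2 ^ e * cnt (A j) (2 ^ l0)).
      { apply Rmult_le_pos; [left; apply pow2_pos | apply cnt_nonneg]. }
      specialize (Hsum l0 HN0). rewrite <- E1 in Hsum.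
      rewrite !Rmult_assoc. apply Rmult_le_compat_l; [lra|].
      now apply Rmult_le_compat_r. }
  assert (C2 : cnt R2 (2 ^ l2) <= 4 * Rpower 2 (- ((1 - s) * INR l1)) * 2 ^ l2)
    by (apply cnt_small_cover; assumption).
  set (t := Rpower 2 (- ((1 - s) * INR l1))) in *.
  assert (HD' : 2 ^ l2 = 2 ^ l1 * INR D) by (rewrite <- !INR_pow2, HD; apply mult_INR).
  assert (He' : 2 ^ l2 = 2 ^ l0 * 2 ^ e) by (rewrite Hl; apply pow_add).
  pose proof (pow2_pos l0). pose proof (pow2_pos l1). pose proof (pow2_pos l2).
  apply Rmult_le_reg_r with (2 ^ l2); [assumption|].
  replace (cnt (A (S (S j))) (2 ^ l2) / 2 ^ l2 * 2 ^ l2)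
    with (cnt (A (S (S j))) (2 ^ l2)) by (field; lra).
  rewrite !Rmult_minus_distr_r.
  replace (cnt (A (S j)) (2 ^ l1) / 2 ^ l1 * 2 ^ l2) with (INR D * cnt (A (S j)) (2 ^ l1))
    by (rewrite HD'; field; lra).
  replace (/ 8 * (cnt (A j) (2 ^ l0) / 2 ^ l0) * 2 ^ l2)
    with (12 * / 96 * 2 ^ e * cnt (A j) (2 ^ l0)) by (rewrite He'; field; lra).
  lra.
Qed.

(** The density stays positive at every stage, so survivors exist throughout and a limit point
    avoids all bad sets. It remains to see that each [q >= 2^N0] and each cover member is treated at
    some stage. *)
Lemma exists_avoiding_point N0 psi U d s :
  0 < s < 1 -> 5 <= (1 - s) * INR N0 ->
  (forall q, (2 ^ N0 <= q)%nat -> psi q <= / 2 /\ 1 <= psi q * INR q ^ 3) ->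
  (forall N, (N0 <= N)%nat -> sumn (tail (2 ^ N) psi) (2 ^ (4 * N)) <= / 96) ->
  (forall k, 0 < d k) -> (forall k, d k * 2 ^ (4 * N0) < 1) ->
  (forall k x y, U k x -> U k y -> Rabs (x - y) <= d k) ->
  (forall F, sumn (fun k => Rpower (d k) s) F <= 1) ->
  exists x, (forall q (r : Z), (2 ^ N0 <= q)%nat -> psi q <= Rabs (INR q * x - IZR r))
            /\ forall k, ~ U k x.
Proof.
  intros Hs HN0 Hpsi Hsum Hd Hd1 Hdiam Hds.
  assert (PN0 : (1 <= N0)%nat).
  { destruct N0; [simpl in HN0; lra | lia]. }
  set (B := bad N0 psi U d).
  set (b := density (lev N0) B).
  assert (Hlev : forall n, (lev N0 n <= lev N0 (S n))%nat)
    by (intros n; rewrite lev_S; lia).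
  assert (b0 : b O = 1).
  { unfold b, density. simpl survivors.
    replace (cnt _ _) with (INR (2 ^ lev N0 0)) by (symmetry; apply cnt_all).
    rewrite INR_pow2. field. pose proof (pow2_pos (lev N0 0)). lra. }
  assert (b1 : b 1%nat = 1).
  { rewrite <- b0. apply density_trivial_step; [apply Hlev | now intros x]. }
  (* The halving bound feeds itself: [b j <= 2 b (S j)] makes the loss to fractions at most
     [b (S j) / 4], and the loss to the cover is at most [2^-(j+1) / 4 <= b (S j) / 4], leaving half
     of [b (S j)]. *)
  assert (Hb : forall j, b j / 2 <= b (S j) /\ / 2 ^ j <= b j).
  { induction j as [|j [IH1 IH2]].
    - rewrite b0, b1. simpl. lra.
    - assert (P : / 2 ^ S j <= b (S j)).
      { simpl. rewrite Rinv_mult. lra. }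
      split; [|exact P].
      pose proof (density_step N0 psi U d s j Hs Hpsi Hsum Hd Hdiam Hds) as St.
      cbv zeta in St. fold B b in St.
      (* Since [lev N0 (S j) >= N0 (j + 2)] and [(1 - s) N0 >= 5], the exponent is at least
         [5 (j + 2) >= j + 5]. *)
      assert (T : Rpower 2 (- ((1 - s) * INR (lev N0 (S j)))) <= / 2 ^ S j / 16).
      { replace (/ 2 ^ S j / 16) with (Rpower 2 (- INR (S j + 4))).
        - apply Rle_Rpower; [lra|]. apply Ropp_le_contravar.
          pose proof (lev_ge N0 (S j)) as G. apply le_INR in G.
          rewrite mult_INR in G. rewrite plus_INR, (INR_IZR_INZ 4). simpl IZR.
          assert (1 <= INR (S j)) by (rewrite S_INR; pose proof (pos_INR j); lra).
          rewrite (S_INR (S j)) in G.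
          assert ((1 - s) * (INR N0 * (INR (S j) + 1)) <= (1 - s) * INR (lev N0 (S j)))
            by (apply Rmult_le_compat_l; lra).
          assert (5 * (INR (S j) + 1) <= (1 - s) * INR N0 * (INR (S j) + 1))
            by (apply Rmult_le_compat_r; lra).
          lra.
        - rewrite Rpower_Ropp, Rpower_pow by lra.
          rewrite pow_add. pose proof (pow2_pos (S j)). simpl (2 ^ 4). field.
          simpl in *; lra. }
      lra. }
  destruct (survivors_limit (lev N0) B Hlev) as [x Hx].
  { intros j. apply cnt_pos. destruct (Hb j) as [_ H2]. unfold b, density in H2.
    pose proof (pow2_pos j) as Pj. apply Rinv_0_lt_compat in Pj.
    pose proof (pow2_pos (lev N0 j)) as Pl.
    apply Rmult_lt_reg_r with (/ 2 ^ lev N0 j); [now apply Rinv_0_lt_compat|].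
    unfold Rdiv in H2. lra. }
  assert (HB : forall j, ~ B (S j) x).
  { intros j. destruct (Hx (S j)) as [m [[_ H1] H2]]. now apply H1. }
  exists x. split.
  - intros q r Hq.
    destruct (Rle_lt_dec (psi q) (Rabs (INR q * x - IZR r))) as [|L]; [assumption|].
    exfalso.
    (* This locates the range [2^(lev j) <= q < 2^(lev (j+1))], removed at stage [j + 2]. *)
    destruct (nat_crossing (fun j => q < 2 ^ lev N0 j)%nat q) as [j [J1 J2]].
    + unfold lev. rewrite Nat.mul_1_r. lia.
    + apply Nat.lt_le_trans with (2 ^ q)%nat; [apply Nat.pow_gt_lin_r; lia|].
      apply Nat.pow_le_mono_r; [lia|]. pose proof (lev_ge N0 q). nia.
    + apply (HB (S j)). left. exists q. split; [lia|]. now exists r.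
  - intros k HU.
    destruct (INR_archimed 1 (/ d k) Rlt_0_1) as [n Hn]. rewrite Rmult_1_r in Hn.
    (* The predicate fails at 0 because [lev N0 1 = 4 N0] and [d k * 2^(4 N0) < 1]; it holds at [n]
       because [n > 1 / d k]. *)
    destruct (nat_crossing (fun j => 1 <= d k * 2 ^ lev N0 (S j)) n) as [j [J1 J2]].
    + rewrite lev_S. unfold lev. rewrite Nat.mul_1_r. specialize (Hd1 k). lra.
    + specialize (Hd k).
      assert (H2 : INR n <= 2 ^ lev N0 (S n)).
      { rewrite <- INR_pow2. apply le_INR. apply Nat.le_trans with (2 ^ n)%nat.
        - apply Nat.lt_le_incl, Nat.pow_gt_lin_r; lia.
        - apply Nat.pow_le_mono_r; [lia|]. pose proof (lev_ge N0 (S n)). nia. }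
      apply Rmult_le_reg_l with (/ d k); [now apply Rinv_0_lt_compat|].
      rewrite <- Rmult_assoc, Rinv_l by lra. lra.
    + apply (HB (S j)). right. exists k. split; [split; [assumption | lra] | assumption].
Qed.

(** * The lower bound for the Hausdorff dimension *)

Lemma geometric_half_sum n : sumn (fun k => (/ 2) ^ S k) n <= 1.
Proof.
  assert (E : sumn (fun k => (/ 2) ^ S k) n = 1 - (/ 2) ^ n).
  { induction n as [|n IH]; [simpl; ring|].
    cbn [sumn]. rewrite IH. simpl. field. }
  rewrite E. assert (0 < (/ 2) ^ n) by (apply pow_lt; lra). lra.
Qed.

Lemma dist_nint_ge x c :
  (forall r : Z, c <= Rabs (x - IZR r)) -> c <= dist_nint x.
Proof.
  intros H. unfold dist_nint. destruct (base_Int_part x) as [H1 H2].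
  apply Rmin_glb.
  - specialize (H (Int_part x)). rewrite Rabs_pos_eq in H; lra.
  - specialize (H (Int_part x + 1)%Z). rewrite plus_IZR in H.
    rewrite Rabs_left1 in H; lra.
Qed.

(** If [s < 1], nullity supplies a fine cover of [E] with small [s]-sum; the avoiding point then
    lies in [E] and in no member of the cover. *)
Lemma hausdorff_null_exponent_ge_1 (E : R -> Prop) (psi : nat -> R) N1 s :
  (forall q, (2 ^ N1 <= q)%nat -> psi q <= / 2 /\ 1 <= psi q * INR q ^ 3) ->
  (forall N, (N1 <= N)%nat -> sumn (tail (2 ^ N) psi) (2 ^ (4 * N)) <= / 96) ->
  (forall x N, (forall q, (N <= q)%nat -> psi q <= dist_nint (INR q * x)) -> E x) ->
  0 <= s -> Hausdorff_null s E -> 1 <= s.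
Proof.
  intros Hpsi Hsum HE Hs Hnull.
  destruct (Rle_lt_dec 1 s) as [|Hs1]; [assumption|exfalso].
  (* The scheme runs with [s'] instead of [s]: being at least [1/2] even for [s = 0], it makes the
     powers of the added diameters summable. *)
  set (s' := (1 + s) / 2).
  assert (Hs' : 1 / 2 <= s' < 1 /\ s <= s') by (unfold s'; lra).
  destruct (INR_archimed (1 - s') 5 ltac:(lra)) as [N2 HN2].
  set (N0 := Nat.max N1 N2).
  assert (HN0 : 5 <= (1 - s') * INR N0).
  { assert (INR N2 <= INR N0) by (apply le_INR; lia). nra. }
  pose proof (pow2_pos (4 * N0)) as P4.
  assert (P4' : 1 <= 2 ^ (4 * N0)) by (apply pow_R1_Rle; lra).
  (* This mesh keeps every [d n * 2^(4 N0)] at most [1/2], and the bound [1/2] on the sum leaves the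
     other half for the enlargement. *)
  destruct (Hnull (/ (2 * 2 ^ (4 * N0))) ltac:(apply Rinv_0_lt_compat; lra)
              (/ 2) ltac:(lra)) as [U [d [Hd [Hdiam [Hcov Hds]]]]].
  assert (Hd' : forall n, 0 <= d n /\ d n * 2 ^ (4 * N0) <= / 2).
  { intros n. destruct (Hd n) as [D1 D2]. split; [assumption|].
    apply Rmult_le_compat_r with (r := 2 ^ (4 * N0)) in D2; [|lra].
    rewrite Rinv_mult, Rmult_assoc, Rinv_l, Rmult_1_r in D2 by lra. lra. }
  (* Some [d n] may vanish: enlarge them all by a summable amount. *)
  set (eta := fun n : nat => (/ 4) ^ (S (S n) + 4 * N0)).
  assert (Peta : forall n, 0 < eta n) by (intros; apply pow_lt; lra).
  (* As [eta n <= 1] and [s' >= 1/2], the power is at most [sqrt (eta n) = 2^-(n + 2 + 4 N0)]. *)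
  assert (Heta1 : forall n, Rpower (eta n) s' <= / 2 * (/ 2) ^ S n).
  { intros n. apply Rle_trans with (Rpower (eta n) (/ 2)).
    - assert (Le : eta n <= 1).
      { unfold eta. rewrite <- (pow1 (S (S n) + 4 * N0)). apply pow_incr. lra. }
      unfold Rpower. assert (ln (eta n) <= 0).
      { rewrite <- ln_1. destruct Le as [Le| ->]; [left; apply ln_increasing; auto | lra]. }
      assert (X : s' * ln (eta n) <= / 2 * ln (eta n)) by nra.
      destruct X as [X| ->]; [left; now apply exp_increasing | lra].
    - rewrite Rpower_sqrt by apply Peta. unfold eta.
      replace ((/ 4) ^ (S (S n) + 4 * N0)) with (Rsqr ((/ 2) ^ (S (S n) + 4 * N0))).
      + rewrite sqrt_Rsqr by (apply pow_le; lra). rewrite pow_add.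
        assert (G : (/ 2) ^ (4 * N0) <= 1).
        { rewrite <- (pow1 (4 * N0)). apply pow_incr. lra. }
        assert (0 < (/ 2) ^ S (S n)) by (apply pow_lt; lra).
        change ((/ 2) ^ S (S n)) with (/ 2 * (/ 2) ^ S n) in *. nra.
      + unfold Rsqr. rewrite <- Rpow_mult_distr. f_equal. lra. }
  assert (Heta2 : forall n, eta n * 2 ^ (4 * N0) < 1).
  { intros n. unfold eta. rewrite pow_add, Rmult_assoc, <- Rpow_mult_distr.
    replace (/ 4 * 2) with (/ 2) by lra.
    assert ((/ 2) ^ (4 * N0) <= 1).
    { rewrite <- (pow1 (4 * N0)). apply pow_incr. lra. }
    assert (0 < (/ 2) ^ (4 * N0)) by (apply pow_lt; lra).
    assert ((/ 4) ^ n <= 1).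
    { rewrite <- (pow1 n). apply pow_incr. lra. }
    assert (0 < (/ 4) ^ n) by (apply pow_lt; lra).
    simpl ((/ 4) ^ S (S n)). nra. }
  set (d' := fun n => Rmax (d n) (eta n)).
  destruct (exists_avoiding_point N0 psi U d' s') as [x [Hx HU]].
  - lra.
  - exact HN0.
  - intros q Hq. apply Hpsi. apply Nat.le_trans with (2 := Hq).
    apply Nat.pow_le_mono_r; lia.
  - intros N HN. apply Hsum. lia.
  - intros k. unfold d'. apply Rlt_le_trans with (eta k); [apply Peta | apply Rmax_r].
  - intros k. unfold d'. destruct (Hd' k). specialize (Heta2 k).
    unfold Rmax. destruct Rle_dec; lra.
  - intros k y z Hy Hz. apply Rle_trans with (d k); [now apply (Hdiam k) | apply Rmax_l].
  - intros F.
    assert (Tm : forall k, Rpower (d' k) s' <= hpow (d k) s + / 2 * (/ 2) ^ S k).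
    { intros k. specialize (Heta1 k). unfold d', Rmax.
      assert (Hh : 0 <= hpow (d k) s).
      { unfold hpow. destruct Rle_dec; [lra | left; apply exp_pos]. }
      destruct Rle_dec as [L|L]; [lra|].
      assert (Pk : 0 < d k) by (specialize (Peta k); lra).
      unfold hpow in *. destruct (Rle_dec (d k) 0); [lra|].
      assert (Rpower (d k) s' <= Rpower (d k) s).
      { assert (Le : d k <= 1) by (destruct (Hd' k); nra).
        unfold Rpower. assert (ln (d k) <= 0).
        { rewrite <- ln_1. destruct Le as [Le| ->]; [left; apply ln_increasing; auto | lra]. }
        assert (X : s' * ln (d k) <= s * ln (d k)) by nra.
        destruct X as [X| ->]; [left; now apply exp_increasing | lra]. }
      assert (0 < (/ 2) ^ S k) by (apply pow_lt; lra). lra. }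
    eapply Rle_trans; [apply sumn_le; intros k _; apply Tm|].
    rewrite sumn_plus, sumn_scal. pose proof (geometric_half_sum F).
    assert (sumn (fun i => hpow (d i) s) F <= / 2); [|lra].
    destruct F as [|F]; [simpl; lra|].
    specialize (Hds F). rewrite sum_f_R0_sumn in Hds. lra.
  - destruct (Hcov x) as [n Hn]; [|now apply (HU n)].
    apply (HE x (2 ^ N0)%nat). intros q Hq. apply dist_nint_ge. intros r. now apply Hx.
Qed.


(** * Inequalities for logarithms and powers, and the sums they control *)

Lemma ln_le_compat x y : 0 < x -> x <= y -> ln x <= ln y.
Proof. intros Hx [H| ->]; [left; now apply ln_increasing | lra]. Qed.

Lemma exp_le_compat x y : x <= y -> exp x <= exp y.
Proof. intros [H| ->]; [left; now apply exp_increasing | lra]. Qed.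

(** Take logarithms in [1 - 1/(x+1) <= exp (-1/(x+1))]. *)
Lemma inv_succ_le_ln x : 0 < x -> / (x + 1) <= ln (x + 1) - ln x.
Proof.
  intros Hx. pose proof (exp_ineq1_le (- / (x + 1))) as H.
  replace (1 + - / (x + 1)) with (x / (x + 1)) in H by (field; lra).
  apply ln_le_compat in H; [|apply Rdiv_lt_0_compat; lra].
  rewrite ln_exp in H. unfold Rdiv in H.
  rewrite ln_mult, ln_Rinv in H by (try apply Rinv_0_lt_compat; lra). lra.
Qed.

(** Comparison with the integral of [u^(-1-t)] over [[x, x+1]], obtained from [exp (t l) >= 1 + t l]
    with [l = ln (x+1) - ln x >= 1/(x+1)]. *)
Lemma Rpower_le_telescope_down x t :
  0 < x -> 0 < t ->
  Rpower (x + 1) (- (1 + t)) <= / t * (Rpower x (- t) - Rpower (x + 1) (- t)).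
Proof.
  intros Hx Ht. pose proof (inv_succ_le_ln x Hx) as L.
  set (y := x + 1) in *. set (l := ln y - ln x) in *.
  assert (E1 : Rpower x (- t) = Rpower y (- t) * exp (t * l)).
  { unfold Rpower. rewrite <- exp_plus. f_equal. unfold l. ring. }
  assert (E2 : Rpower y (- (1 + t)) = Rpower y (- t) * / y).
  { replace (- (1 + t)) with (- t + Ropp 1) by ring.
    rewrite Rpower_plus, (Rpower_Ropp y 1), Rpower_1; [reflexivity | unfold y; lra]. }
  pose proof (exp_ineq1_le (t * l)) as X.
  assert (P : 0 < Rpower y (- t)) by apply exp_pos.
  rewrite E1, E2.
  replace (/ t * (Rpower y (- t) * exp (t * l) - Rpower y (- t)))
    with (Rpower y (- t) * (/ t * (exp (t * l) - 1))) by ring.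
  apply Rmult_le_compat_l; [lra|].
  apply Rmult_le_reg_l with t; [assumption|].
  rewrite <- Rmult_assoc, Rinv_r by lra. nra.
Qed.

(** The counterpart for growing powers. The factor 2 is the cost of the elementary bound
    [exp (-u) <= 1/(1+u) <= 1 - u/2], with [u = b/(x+1)]. *)
Lemma Rpower_le_telescope_up x b :
  1 <= x -> 0 < b <= 1 ->
  Rpower (x + 1) (b - 1) <= 2 / b * (Rpower (x + 1) b - Rpower x b).
Proof.
  intros Hx Hb. pose proof (inv_succ_le_ln x ltac:(lra)) as L.
  set (y := x + 1) in *.
  assert (Hy : 2 <= y) by (unfold y; lra).
  set (l := ln y - ln x) in *.
  assert (E1 : Rpower x b = Rpower y b * exp (- (b * l))).
  { unfold Rpower. rewrite <- exp_plus. f_equal. unfold l. ring. }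
  assert (E2 : Rpower y (b - 1) = Rpower y b * / y).
  { unfold Rminus. rewrite Rpower_plus, Rpower_Ropp, Rpower_1; [reflexivity | lra]. }
  set (u := b * / y).
  assert (Piy : 0 < / y) by (apply Rinv_0_lt_compat; lra).
  assert (Hiy : / y <= / 2) by (apply Rinv_le_contravar; lra).
  assert (Hu : 0 < u <= / 2) by (unfold u; nra).
  assert (X : exp (- (b * l)) <= 1 - u / 2).
  { apply Rle_trans with (exp (- u)); [apply exp_le_compat; unfold u; nra|].
    rewrite exp_Ropp. pose proof (exp_ineq1_le u).
    apply Rle_trans with (/ (1 + u)); [apply Rinv_le_contravar; lra|].
    apply Rmult_le_reg_l with (1 + u); [lra|]. rewrite Rinv_r by lra. nra. }
  assert (P : 0 < Rpower y b) by apply exp_pos.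
  rewrite E1, E2.
  replace (2 / b * (Rpower y b - Rpower y b * exp (- (b * l))))
    with (Rpower y b * (2 / b * (1 - exp (- (b * l))))) by ring.
  apply Rmult_le_compat_l; [lra|].
  apply Rle_trans with (2 / b * (u / 2)).
  - right. unfold u. field. lra.
  - apply Rmult_le_compat_l; [|lra]. apply Rmult_le_pos; [lra|].
    left; apply Rinv_0_lt_compat; lra.
Qed.

Lemma Rpower_1_l z : Rpower 1 z = 1.
Proof. unfold Rpower. rewrite ln_1, Rmult_0_r. apply exp_0. Qed.

Lemma sum_Rpower_gt1 s F :
  1 < s -> sumn (fun n => Rpower (INR (S n)) (- s)) F <= 1 + / (s - 1).
Proof.
  intros Hs. set (t := s - 1).
  assert (Ht : 0 < / t) by (apply Rinv_0_lt_compat; unfold t; lra).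
  assert (G : forall n, sumn (fun n => Rpower (INR (S n)) (- s)) (S n)
              <= 1 + / t * (1 - Rpower (INR (S n)) (- t))).
  { induction n as [|n IH].
    - cbn [sumn]. change (INR 1) with 1. rewrite !Rpower_1_l. lra.
    - change (sumn (fun n => Rpower (INR (S n)) (- s)) (S n)
              + Rpower (INR (S (S n))) (- s)
              <= 1 + / t * (1 - Rpower (INR (S (S n))) (- t))).
      pose proof (Rpower_le_telescope_down (INR (S n)) t
                    (lt_0_INR _ (Nat.lt_0_succ n)) ltac:(unfold t; lra)) as T.
      replace (- (1 + t)) with (- s) in T by (unfold t; ring).
      rewrite <- S_INR in T. lra. }
  destruct F as [|F]; [simpl; lra|].
  eapply Rle_trans; [apply G|].
  assert (0 < Rpower (INR (S F)) (- t)) by apply exp_pos. nra.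
Qed.

Lemma sum_Rpower_lt1 a n :
  0 <= a < 1 -> (1 <= n)%nat ->
  sumn (fun k => Rpower (INR (S k)) (- a)) n <= 2 / (1 - a) * Rpower (INR n) (1 - a).
Proof.
  intros Ha Hn. induction Hn as [|n Hn IH].
  - cbn [sumn]. change (INR 1) with 1. rewrite !Rpower_1_l.
    apply Rmult_le_reg_r with (1 - a); [lra|].
    replace (2 / (1 - a) * 1 * (1 - a)) with 2 by (field; lra). lra.
  - change (sumn (fun k => Rpower (INR (S k)) (- a)) n + Rpower (INR (S n)) (- a)
            <= 2 / (1 - a) * Rpower (INR (S n)) (1 - a)).
    assert (1 <= INR n) by (apply (le_INR 1); assumption).
    pose proof (Rpower_le_telescope_up (INR n) (1 - a) ltac:(assumption) ltac:(lra)) as T.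
    replace (1 - a - 1) with (- a) in T by ring. rewrite S_INR. lra.
Qed.

(* At [m = 0] the summand is [/ 0 = 0]. *)
Lemma harmonic_le n :
  (1 <= n)%nat -> sumn (fun m => / INR m) n <= 1 + ln (INR n).
Proof.
  intros Hn. apply Rle_trans with (sumn (fun m => / INR m) (S n)).
  { cbn [sumn]. assert (0 < / INR n) by (apply Rinv_0_lt_compat, lt_0_INR; lia). lra. }
  induction Hn as [|n Hn IH].
  - simpl. rewrite Rinv_0, ln_1. lra.
  - change (sumn (fun m => / INR m) (S n) + / INR (S n) <= 1 + ln (INR (S n))).
    pose proof (inv_succ_le_ln (INR n) ltac:(apply lt_0_INR; lia)) as L.
    rewrite S_INR in *. lra.
Qed.

(** Extend the range to [Q * d] and cut it into blocks of length [d]: each contains exactly one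
    multiple of [d], its first element. *)
Lemma sumn_multiples f d Q :
  (1 <= d)%nat -> (forall m, 0 <= f m) ->
  sumn (fun q => if (q mod d =? 0)%nat then f (q / d)%nat else 0) Q <= sumn f Q.
Proof.
  intros Hd Hf. eapply Rle_trans; [apply sumn_mono with (n := (Q * d)%nat)|].
  - intros i. destruct (_ =? _)%nat; [apply Hf | lra].
  - nia.
  - rewrite sumn_block. right. apply sumn_ext. intros J _.
    transitivity (sumn (fun i => if (i =? 0)%nat then f J else 0) d).
    + apply sumn_ext. intros i Hi. rewrite div_block by assumption.
      rewrite Nat.add_comm, Nat.Div0.mod_add, Nat.mod_small by assumption. reflexivity.
    + clear -Hd. induction Hd as [|d Hd IH]; [simpl; ring|].
      cbn [sumn]. rewrite IH. destruct (Nat.eqb_spec d 0); [lia | ring].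
Qed.

(** * The upper bound for the Hausdorff dimension *)

(* The points [(kappa / 2) ln m] and their opposites cut the line into intervals of
   length at most [kappa / (2 m)]. *)
Lemma hausdorff_null_gt1 E s : 1 < s -> Hausdorff_null s E.
Proof.
  intros Hs delta Hdelta eps Heps. rewrite Rplus_0_l.
  set (C := 1 + / (s - 1)).
  assert (PC : 1 < C).
  { unfold C. assert (0 < / (s - 1)) by (apply Rinv_0_lt_compat; lra). lra. }
  (* The three bounds serve the mesh, the inequality [kappa^s <= kappa], and the total
     [kappa * C <= eps]. *)
  set (kappa := Rmin delta (Rmin 1 (eps / C))).
  assert (Pe : 0 < eps / C) by (apply Rdiv_lt_0_compat; lra).
  assert (Hk : 0 < kappa /\ kappa <= delta /\ kappa <= 1 /\ kappa <= eps / C).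
  { unfold kappa. pose proof (Rmin_l delta (Rmin 1 (eps / C))).
    pose proof (Rmin_r delta (Rmin 1 (eps / C))).
    pose proof (Rmin_l 1 (eps / C)). pose proof (Rmin_r 1 (eps / C)).
    repeat split; try lra. repeat apply Rmin_glb_lt; lra. }
  destruct Hk as [K0 [K1 [K2 K3]]].
  set (T := fun m => kappa / 2 * ln (INR (S m))).
  assert (HT : forall m, T (S m) - T m <= kappa / (2 * INR (S m))).
  { intros m. unfold T. rewrite (S_INR (S m)).
    assert (P : 0 < INR (S m)) by (apply lt_0_INR; lia).
    assert (L : ln (INR (S m) + 1) - ln (INR (S m)) <= / INR (S m)).
    { assert (ln (INR (S m) + 1) <= ln (exp (ln (INR (S m)) + / INR (S m))));
        [|rewrite ln_exp in *; lra].
      apply ln_le_compat; [lra|]. rewrite exp_plus, exp_ln by assumption.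
      pose proof (exp_ineq1_le (/ INR (S m))).
      apply Rle_trans with (INR (S m) * (1 + / INR (S m))).
      - right. field. lra.
      - apply Rmult_le_compat_l; lra. }
    replace (kappa / (2 * INR (S m))) with (kappa / 2 * / INR (S m)) by (field; lra).
    nra. }
  (* Even [n] covers the positive copy of interval [n / 2], odd [n] the negative one. The diameter
     bound [kappa / (n + 1)] is valid since [n + 1 <= 2 (n / 2 + 1)]. *)
  set (side := fun (n : nat) x => if Nat.even n then 0 <= x else x <= 0).
  exists (fun n x => T (n / 2)%nat <= Rabs x <= T (S (n / 2)) /\ side n x).
  exists (fun n => kappa / INR (S n)).
  assert (Pd : forall n, 0 < kappa / INR (S n))
    by (intros n; apply Rdiv_lt_0_compat; [lra | apply lt_0_INR; lia]).
  split; [|split; [|split]].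
  - intros n. split; [left; apply Pd|]. apply Rle_trans with kappa; [|assumption].
    assert (1 <= INR (S n)) by (apply (le_INR 1); lia).
    apply Rmult_le_reg_r with (INR (S n)); [lra|].
    replace (kappa / INR (S n) * INR (S n)) with kappa by (field; lra). nra.
  - intros n x y [Hx Sx] [Hy Sy].
    apply Rle_trans with (T (S (n / 2)) - T (n / 2)%nat).
    + unfold side in *. destruct (Nat.even n); unfold Rabs in *;
        repeat destruct Rcase_abs; lra.
    + eapply Rle_trans; [apply HT|]. unfold Rdiv. apply Rmult_le_compat_l; [lra|].
      apply Rinv_le_contravar; [apply lt_0_INR; lia|].
      change 2 with (INR 2). rewrite <- mult_INR. apply le_INR.
      pose proof (Nat.div_mod_eq n 2). pose proof (Nat.mod_upper_bound n 2). lia.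
  - intros x _.
    destruct (INR_archimed 1 (exp (2 / kappa * Rabs x)) Rlt_0_1) as [n Hn].
    rewrite Rmult_1_r in Hn.
    destruct (nat_crossing (fun m => Rabs x < T m) n) as [m [M1 M2]].
    + unfold T. change (INR 1) with 1. rewrite ln_1. pose proof (Rabs_pos x). lra.
    + assert (L : 2 / kappa * Rabs x < ln (INR (S n))).
      { rewrite <- (ln_exp (2 / kappa * Rabs x)). apply ln_increasing; [apply exp_pos|].
        rewrite S_INR. lra. }
      apply Rmult_lt_compat_l with (r := kappa / 2) in L; [|lra].
      replace (kappa / 2 * (2 / kappa * Rabs x)) with (Rabs x) in L by (field; lra).
      exact L.
    + destruct (Rle_lt_dec 0 x) as [Hx|Hx].
      * exists (2 * m)%nat. unfold side. rewrite Nat.even_even.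
        replace (2 * m / 2)%nat with m by (rewrite Nat.mul_comm, Nat.div_mul; lia).
        split; lra.
      * exists (2 * m + 1)%nat. unfold side. rewrite Nat.even_odd.
        replace ((2 * m + 1) / 2)%nat with m
          by (rewrite Nat.add_comm, Nat.mul_comm, Nat.div_add; simpl; lia).
        split; lra.
  - intros N. rewrite sum_f_R0_sumn.
    apply Rle_trans with (sumn (fun n => kappa * Rpower (INR (S n)) (- s)) (S N)).
    + apply sumn_le. intros n _. specialize (Pd n).
      unfold hpow. destruct Rle_dec as [L|_]; [lra|].
      assert (P : 0 < INR (S n)) by (apply lt_0_INR; lia).
      unfold Rdiv. rewrite <- Rpower_mult_distr by (try apply Rinv_0_lt_compat; assumption).
      replace (Rpower (/ INR (S n)) s) with (Rpower (INR (S n)) (- s))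
        by (unfold Rpower; rewrite ln_Rinv by assumption; f_equal; ring).
      apply Rmult_le_compat_r; [left; apply exp_pos|].
      rewrite <- (Rpower_1 kappa) at 2 by assumption.
      unfold Rpower. apply exp_le_compat.
      assert (ln kappa <= 0) by (rewrite <- ln_1; apply ln_le_compat; lra). nra.
    + rewrite sumn_scal. pose proof (sum_Rpower_gt1 s (S N) Hs) as G. fold C in G.
      apply Rle_trans with (kappa * C); [apply Rmult_le_compat_l; lra|].
      apply Rmult_le_compat_r with (r := C) in K3; [|lra].
      replace (eps / C * C) with eps in K3 by (field; lra). exact K3.
Qed.


(** * The weight of a denominator and the sums of its reciprocal *)

Lemma vp_factor p q : (1 <= p)%nat -> exists m, q = (p ^ vp p q * m)%nat.
Proof.
  intros Hp. unfold vp. generalize q at 2 as fuel. intros fuel; revert q.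
  induction fuel as [|f IH]; intros q; simpl; [exists q; lia|].
  destruct (q =? 0)%nat; [exists q; simpl; lia|].
  destruct (Nat.eqb_spec (q mod p) 0) as [H|H]; [|exists q; simpl; lia].
  destruct (IH (q / p)%nat) as [m Hm]. exists m. simpl.
  pose proof (Nat.div_mod_eq q p) as E. rewrite H, Nat.add_0_r in E.
  rewrite E at 1. rewrite Hm at 1. ring.
Qed.

(** The expression under the liminf without the distance factor: the condition asks for distances at
    least [c / weight a p q] for all large [q]. *)
Definition weight (a : R) (p q : nat) : R :=
  INR q * Rpower (ln (INR q)) (2 - a) * padic_abs p q
    * Rpower (ln (2 / padic_abs p q)) a.

(** With [P = p^v], [v] the valuation, [|q|_p = 1/P] and [q |q|_p = m]. The last bound follows from
    [2 P >= 2^(v+1)] and [ln 2 > 1/2]. *)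
Lemma weight_factor a p q :
  (2 <= p)%nat -> (1 <= q)%nat ->
  exists m, let P := (p ^ vp p q)%nat in
    q = (P * m)%nat /\ (1 <= m)%nat /\ (2 ^ vp p q <= P)%nat /\
    weight a p q = INR m * Rpower (ln (INR q)) (2 - a) * Rpower (ln (2 * INR P)) a /\
    (INR (S (vp p q))) / 2 <= ln (2 * INR P).
Proof.
  intros Hp Hq. destruct (vp_factor p q ltac:(lia)) as [m Hm]. exists m. cbv zeta.
  set (P := (p ^ vp p q)%nat) in *.
  assert (HP : (2 ^ vp p q <= P)%nat) by (apply Nat.pow_le_mono_l; lia).
  assert (Hm1 : (1 <= m)%nat) by (destruct m; lia).
  assert (PP : 0 < INR P).
  { apply lt_0_INR. assert (2 ^ vp p q <> 0)%nat by (apply Nat.pow_nonzero; lia). lia. }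
  repeat split; try assumption.
  - unfold weight, padic_abs. rewrite <- pow_INR. fold P.
    replace (2 / / INR P) with (2 * INR P) by (field; lra).
    rewrite Hm at 1. rewrite mult_INR. field. lra.
  - apply le_INR in HP. rewrite INR_pow2 in HP.
    apply Rle_trans with (ln (2 ^ S (vp p q))).
    + rewrite ln_pow by lra. pose proof ln_lt_2. pose proof (pos_INR (S (vp p q))). nra.
    + apply ln_le_compat; [apply pow2_pos|]. simpl. lra.
Qed.

Lemma Rpower_half_ge a : 0 <= a <= 1 -> / 2 <= Rpower (/ 2) a.
Proof.
  intros Ha. rewrite <- (Rpower_1 (/ 2)) at 1 by lra. unfold Rpower.
  apply exp_le_compat. rewrite ln_Rinv by lra. pose proof ln_lt_2. nra.
Qed.

Lemma Rpower_ge_1 x z : 1 <= x -> 0 <= z -> 1 <= Rpower x z.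
Proof.
  intros Hx Hz. rewrite <- (Rpower_1_l z). apply Rpower_mono_base; lra.
Qed.

Lemma ln_ge_1_of_ge_4 x : 4 <= x -> 1 <= ln x.
Proof.
  intros Hx. apply Rle_trans with (ln (2 * 2)).
  - rewrite ln_mult by lra. pose proof ln_lt_2. lra.
  - apply ln_le_compat; lra.
Qed.

Lemma weight_lower a p q :
  0 <= a < 1 -> (2 <= p)%nat -> (4 <= q)%nat -> / 2 <= weight a p q.
Proof.
  intros Ha Hp Hq. destruct (weight_factor a p q Hp ltac:(lia)) as [m H].
  cbv zeta in H. set (P := (p ^ vp p q)%nat) in *.
  destruct H as [_ [Hm [_ [-> HL]]]].
  apply (le_INR 4) in Hq. simpl INR at 1 in Hq.
  apply (le_INR 1) in Hm. change (INR 1) with 1 in Hm.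
  assert (H1 : 1 <= Rpower (ln (INR q)) (2 - a)).
  { apply Rpower_ge_1; [|lra]. apply ln_ge_1_of_ge_4. lra. }
  assert (H2 : / 2 <= Rpower (ln (2 * INR P)) a).
  { apply Rle_trans with (Rpower (/ 2) a); [apply Rpower_half_ge; lra|].
    apply Rpower_mono_base; [lra | | lra].
    rewrite S_INR in HL. pose proof (pos_INR (vp p q)). lra. }
  assert (1 <= INR m * Rpower (ln (INR q)) (2 - a)) by nra. nra.
Qed.

Lemma ln_sqr_le y : 1 <= y -> ln y * ln y <= 4 * y.
Proof.
  intros Hy. pose proof (sqrt_sqrt y ltac:(lra)) as E.
  assert (P : 0 < sqrt y) by (apply sqrt_lt_R0; lra).
  assert (L : ln y = 2 * ln (sqrt y)).
  { rewrite <- E at 1. rewrite ln_mult by assumption. ring. }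
  assert (0 <= ln y) by (rewrite <- ln_1; apply ln_le_compat; lra).
  assert (ln (sqrt y) <= sqrt y).
  { rewrite <- (ln_exp (sqrt y)) at 2. apply ln_le_compat; [assumption|].
    pose proof (exp_ineq1_le (sqrt y)). lra. }
  nra.
Qed.

(** Both logarithms are at most [L = ln (2 q)] and the exponents add up to 2, so their product is at
    most [L^2 <= 8 q]. This yields [psi q >= q^-3] for large [q]. *)
Lemma weight_upper a p q :
  0 <= a < 1 -> (2 <= p)%nat -> (4 <= q)%nat -> weight a p q <= 8 * INR q ^ 2.
Proof.
  intros Ha Hp Hq. destruct (weight_factor a p q Hp ltac:(lia)) as [m H].
  cbv zeta in H. set (P := (p ^ vp p q)%nat) in *.
  destruct H as [Em [Hm [_ [-> HL]]]].
  assert (P0 : (P <> 0)%nat) by (intros Z; rewrite Z in Em; lia).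
  assert (HP : (P <= q)%nat) by nia. assert (Hmq : (m <= q)%nat) by nia.
  apply (le_INR 4) in Hq. simpl INR at 1 in Hq.
  apply (le_INR 1) in Hm. change (INR 1) with 1 in Hm.
  apply le_INR in HP, Hmq.
  rewrite S_INR in HL. pose proof (pos_INR (vp p q)).
  assert (PP : 0 < INR P) by (apply lt_0_INR; lia).
  set (L := ln (2 * INR q)).
  assert (H0 : 1 <= ln (INR q)) by (apply ln_ge_1_of_ge_4; lra).
  assert (H1 : Rpower (ln (INR q)) (2 - a) <= Rpower L (2 - a)).
  { apply Rpower_mono_base; [lra | | lra]. apply ln_le_compat; lra. }
  assert (H2 : Rpower (ln (2 * INR P)) a <= Rpower L a).
  { apply Rpower_mono_base; [lra | | lra]. apply ln_le_compat; lra. }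
  assert (HL1 : 1 <= L) by (apply ln_ge_1_of_ge_4; lra).
  assert (E : Rpower L (2 - a) * Rpower L a = L * L).
  { rewrite <- Rpower_plus. replace (2 - a + a) with (1 + 1) by ring.
    rewrite Rpower_plus, Rpower_1 by lra. reflexivity. }
  pose proof (ln_sqr_le (2 * INR q) ltac:(lra)) as S. fold L in S.
  assert (G : Rpower (ln (INR q)) (2 - a) * Rpower (ln (2 * INR P)) a <= 8 * INR q).
  { apply Rle_trans with (Rpower L (2 - a) * Rpower L a); [|lra].
    apply Rmult_le_compat; auto; left; apply exp_pos. }
  rewrite Rmult_assoc. apply Rle_trans with (INR q * (8 * INR q)); [|simpl; lra].
  apply Rmult_le_compat; auto; [lra|].
  apply Rmult_le_pos; left; apply exp_pos.
Qed.

(* Sorting the [q < Q] by valuation bounds the sum by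
   [(sum_k (k+1)^-a) (sum_m 1/m)]. *)
Lemma sum_valuation_le p a Q V :
  (2 <= p)%nat -> (1 <= Q)%nat ->
  (forall q, (1 <= q < Q)%nat -> (vp p q < V)%nat) ->
  sumn (tail 1 (fun q => Rpower (INR (S (vp p q))) (- a) * / INR (q / p ^ vp p q))) Q
    <= sumn (fun k => Rpower (INR (S k)) (- a)) V * (1 + ln (INR Q)).
Proof.
  intros Hp HQ HV.
  assert (Inv : forall m, 0 <= / INR m).
  { intros [|m]; [simpl; rewrite Rinv_0; lra|].
    left. apply Rinv_0_lt_compat, lt_0_INR. lia. }
  (* Each [q] is charged to every [k < V] with [p^k] dividing [q], its valuation among them; for
     fixed [k] the sum then runs over all multiples of [p^k]. *)
  set (h := fun q k => Rpower (INR (S k)) (- a)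
              * if (q mod p ^ k =? 0)%nat then / INR (q / p ^ k) else 0).
  assert (Hh : forall q k, 0 <= h q k).
  { intros q k. unfold h. apply Rmult_le_pos; [left; apply exp_pos|].
    destruct (_ =? _)%nat; [apply Inv | lra]. }
  apply Rle_trans with (sumn (fun q => sumn (h q) V) Q).
  - apply sumn_le. intros q Hq. unfold tail. destruct (Nat.leb_spec 1 q) as [H1|H1].
    + apply Rle_trans with (h q (vp p q)).
      * unfold h. destruct (vp_factor p q ltac:(lia)) as [m Hm].
        assert (E : (q mod p ^ vp p q)%nat = O).
        { rewrite Hm at 1. rewrite Nat.mul_comm. apply Nat.Div0.mod_mul. }
        rewrite E. simpl. lra.
      * apply sumn_term_le; [apply Hh | apply HV; lia].
    + now apply sumn_nonneg.
  - rewrite sumn_exchange.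
    rewrite (Rmult_comm (sumn _ V)), <- sumn_scal. apply sumn_le. intros k _.
    unfold h. rewrite sumn_scal. rewrite Rmult_comm.
    apply Rmult_le_compat_r; [left; apply exp_pos|].
    eapply Rle_trans; [apply (sumn_multiples (fun m => / INR m)) | now apply harmonic_le].
    + assert (p ^ k <> 0)%nat by (apply Nat.pow_nonzero; lia). lia.
    + exact Inv.
Qed.

(** Insert [ln q >= N/2] and [ln (2 P) >= (v+1)/2]; the halves cost [2^(2-a) <= 4] and [2^a <= 2],
    whence 8. *)
Lemma weight_ge_valuation a p N q :
  0 <= a < 1 -> (2 <= p)%nat -> (1 <= N)%nat -> (2 ^ N <= q)%nat ->
  / weight a p q <= 8 * Rpower (INR N) (a - 2) *
     (Rpower (INR (S (vp p q))) (- a) * / INR (q / p ^ vp p q)).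
Proof.
  intros Ha Hp HN Hq.
  assert (Hq1 : (1 <= q)%nat).
  { assert (2 ^ N <> 0)%nat by (apply Nat.pow_nonzero; lia). lia. }
  destruct (weight_factor a p q Hp Hq1) as [m H].
  cbv zeta in H. set (P := (p ^ vp p q)%nat) in *. set (v := vp p q) in *.
  destruct H as [Em [Hm [HP [-> HL]]]].
  assert (Eq : (q / P = m)%nat).
  { assert (2 ^ v <> 0)%nat by (apply Nat.pow_nonzero; lia).
    rewrite Em, Nat.mul_comm, Nat.div_mul; lia. }
  rewrite Eq.
  assert (HN1 : 1 <= INR N) by (apply (le_INR 1); assumption).
  assert (Hm1 : 1 <= INR m) by (apply (le_INR 1); assumption).
  assert (Hv : 1 <= INR (S v)) by (apply (le_INR 1); lia).
  assert (L : INR N * / 2 <= ln (INR q)).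
  { apply le_INR in Hq. rewrite INR_pow2 in Hq.
    apply Rle_trans with (ln (2 ^ N)); [|apply ln_le_compat; [apply pow2_pos | lra]].
    rewrite ln_pow by lra. pose proof ln_lt_2. nra. }
  assert (G1 : Rpower (INR N) (2 - a) / 4 <= Rpower (ln (INR q)) (2 - a)).
  { apply Rle_trans with (Rpower (INR N * / 2) (2 - a));
      [|apply Rpower_mono_base; lra].
    rewrite <- Rpower_mult_distr by lra. unfold Rdiv.
    apply Rmult_le_compat_l; [left; apply exp_pos|].
    replace (2 - a) with (1 + (1 - a)) by ring. rewrite Rpower_plus, Rpower_1 by lra.
    pose proof (Rpower_half_ge (1 - a) ltac:(lra)). lra. }
  assert (G2 : Rpower (INR (S v)) a / 2 <= Rpower (ln (2 * INR P)) a).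
  { apply Rle_trans with (Rpower (INR (S v) * / 2) a); [|apply Rpower_mono_base; lra].
    rewrite <- Rpower_mult_distr by lra. unfold Rdiv.
    apply Rmult_le_compat_l; [left; apply exp_pos|]. apply Rpower_half_ge; lra. }
  replace (a - 2) with (- (2 - a)) by ring. rewrite !Rpower_Ropp.
  set (X := Rpower (INR N) (2 - a)) in *. set (Y := Rpower (INR (S v)) a) in *.
  assert (PX : 0 < X) by apply exp_pos. assert (PY : 0 < Y) by apply exp_pos.
  apply Rle_trans with (/ (INR m * (X / 4) * (Y / 2))).
  - apply Rinv_le_contravar.
    + repeat apply Rmult_lt_0_compat; lra.
    + apply Rmult_le_compat; [| lra | | exact G2].
      * apply Rmult_le_pos; lra.
      * apply Rmult_le_compat_l; lra.
  - right. field. lra.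
Qed.

(** The powers of [N] cancel: [N^(a-2)] from the weight, [N^(1-a)] from the valuations [k < 4 N],
    and [N] from the harmonic sum. The constant is [320 = 8 * 2 * 4 * 5]. *)
Lemma sum_weight_inv a p N :
  0 <= a < 1 -> (2 <= p)%nat -> (1 <= N)%nat ->
  sumn (tail (2 ^ N) (fun q => / weight a p q)) (2 ^ (4 * N)) <= 320 / (1 - a).
Proof.
  intros Ha Hp HN.
  assert (HN1 : 1 <= INR N) by (apply (le_INR 1); assumption).
  assert (P2N : (1 <= 2 ^ N)%nat).
  { assert (2 ^ N <> 0)%nat by (apply Nat.pow_nonzero; lia). lia. }
  set (g := fun q => Rpower (INR (S (vp p q))) (- a) * / INR (q / p ^ vp p q)).
  set (X := Rpower (INR N) (a - 2)).
  assert (PX : 0 < X) by apply exp_pos.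
  apply Rle_trans with (8 * X * sumn (tail 1 g) (2 ^ (4 * N))).
  { rewrite <- sumn_scal. apply sumn_le. intros q _. unfold tail.
    destruct (Nat.leb_spec (2 ^ N) q) as [H1|H1].
    - destruct (Nat.leb_spec 1 q); [|lia].
      apply weight_ge_valuation; assumption.
    - apply Rmult_le_pos; [lra|]. destruct (Nat.leb_spec 1 q); [|lra].
      unfold g. apply Rmult_le_pos; [left; apply exp_pos|].
      destruct (q / p ^ vp p q)%nat; [simpl; rewrite Rinv_0; lra|].
      left. apply Rinv_0_lt_compat, lt_0_INR. lia. }
  assert (S1 : sumn (tail 1 g) (2 ^ (4 * N)) <=
    sumn (fun k => Rpower (INR (S k)) (- a)) (4 * N) * (1 + ln (INR (2 ^ (4 * N))))).
  { apply sum_valuation_le; [assumption | |].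
    - assert (2 ^ (4 * N) <> 0)%nat by (apply Nat.pow_nonzero; lia). lia.
    - intros q Hq. destruct (weight_factor a p q Hp ltac:(lia)) as [m H].
      cbv zeta in H. destruct H as [Em [Hm [HP _]]].
      apply (Nat.pow_lt_mono_r_iff 2); [lia|]. nia. }
  pose proof (sum_Rpower_lt1 a (4 * N) Ha ltac:(lia)) as S2.
  assert (S3 : 1 + ln (INR (2 ^ (4 * N))) <= 5 * INR N).
  { rewrite INR_pow2, ln_pow by lra. rewrite mult_INR. simpl (INR 4).
    assert (ln 2 <= 1).
    { rewrite <- (ln_exp 1). apply ln_le_compat; [lra|].
      pose proof (exp_ineq1_le 1). lra. }
    nra. }
  set (Y := Rpower (INR N) (1 - a)).
  assert (PY : 0 < Y) by apply exp_pos.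
  assert (S4 : Rpower (INR (4 * N)) (1 - a) <= 4 * Y).
  { rewrite mult_INR. replace (INR 4) with 4 by (simpl; ring).
    rewrite <- Rpower_mult_distr by lra. apply Rmult_le_compat_r; [lra|].
    rewrite <- (Rpower_1 4) at 2 by lra. apply Rle_Rpower; lra. }
  assert (E : X * (INR N * Y) = 1).
  { unfold X, Y. rewrite <- (Rpower_1 (INR N)) at 2 by lra.
    rewrite <- !Rpower_plus. replace (a - 2 + (1 + (1 - a))) with 0 by ring.
    apply Rpower_O. lra. }
  assert (Pa : 0 < 2 / (1 - a)) by (apply Rdiv_lt_0_compat; lra).
  assert (S5 : sumn (tail 1 g) (2 ^ (4 * N)) <= 2 / (1 - a) * (4 * Y) * (5 * INR N)).
  { apply Rle_trans with (1 := S1). apply Rmult_le_compat; [| | |exact S3].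
    - apply sumn_nonneg. intros; left; apply exp_pos.
    - assert (0 <= ln (INR (2 ^ (4 * N)))); [|lra].
      rewrite INR_pow2, ln_pow by lra. pose proof ln_lt_2.
      apply Rmult_le_pos; [apply pos_INR | lra].
    - apply Rle_trans with (1 := S2). apply Rmult_le_compat_l; lra. }
  apply Rle_trans with (8 * X * (2 / (1 - a) * (4 * Y) * (5 * INR N))).
  - apply Rmult_le_compat_l; lra.
  - right. transitivity (320 / (1 - a) * (X * (INR N * Y))); [field; lra|].
    rewrite E. ring.
Qed.

(** * Choice of the constant and combination of the two dimension bounds *)

Theorem theorem5 (a : R) (p : nat) (ha0 : 0 <= a) (ha1 : a < 1)
  (hp : prime (Z.of_nat p)) :
  is_hausdorff_dim (good_set a p) 1.
Proof.
  assert (Hp : (2 <= p)%nat) by (apply prime_ge_2 in hp; lia).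
  split.
  - intros s [Hs Hnull].
    (* [30720 = 320 * 96], so [c] times the bound on the reciprocal weights is exactly [1 / 96]. *)
    set (c := (1 - a) / 30720).
    assert (Hc : 0 < c <= / 4) by (unfold c; lra).
    destruct (INR_archimed 1 (8 / c) Rlt_0_1) as [M HM]. rewrite Rmult_1_r in HM.
    (* The 2 gives [q >= 4] for the weight bounds; [M] gives [q >= 8 / c], which turns [c / (8 q^2)]
       into at least [q^-3]. *)
    set (N1 := (2 + M)%nat).
    assert (HN1 : forall q, (2 ^ N1 <= q)%nat -> (4 <= q)%nat /\ 8 / c <= INR q).
    { intros q Hq.
      assert (M < 2 ^ M)%nat by (apply Nat.pow_gt_lin_r; lia).
      unfold N1 in Hq. rewrite Nat.pow_add_r in Hq. simpl (2 ^ 2)%nat in Hq.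
      split; [lia|]. apply Rle_trans with (INR M); [lra|]. apply le_INR. lia. }
    apply (hausdorff_null_exponent_ge_1 (good_set a p) (fun q => c * / weight a p q) N1 s);
      try assumption.
    + intros q Hq. destruct (HN1 q Hq) as [H4 H8].
      pose proof (weight_lower a p q (conj ha0 ha1) Hp H4) as WL.
      pose proof (weight_upper a p q (conj ha0 ha1) Hp H4) as WU.
      assert (P4 : 4 <= INR q).
      { apply (le_INR 4) in H4. simpl INR at 1 in H4. lra. }
      split.
      * assert (/ weight a p q <= / / 2) by (apply Rinv_le_contravar; lra).
        rewrite Rinv_inv in H. nra.
      * apply Rmult_le_reg_l with (weight a p q); [lra|].
        replace (weight a p q * (c * / weight a p q * INR q ^ 3)) with (c * INR q ^ 3)
          by (field; lra).
        rewrite Rmult_1_r. apply Rle_trans with (1 := WU).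
        apply Rmult_le_compat_l with (r := c) in H8; [|lra].
        replace (c * (8 / c)) with 8 in H8 by (field; lra).
        assert (0 < INR q ^ 2) by (apply pow_lt; lra).
        replace (c * INR q ^ 3) with (c * INR q * INR q ^ 2) by ring. nra.
    + intros N HN.
      apply Rle_trans with (c * sumn (tail (2 ^ N) (fun q => / weight a p q)) (2 ^ (4 * N))).
      * rewrite <- sumn_scal. apply sumn_le. intros q _. unfold tail.
        destruct (_ <=? _)%nat; lra.
      * apply Rle_trans with (c * (320 / (1 - a))).
        -- apply Rmult_le_compat_l; [lra|]. apply sum_weight_inv; auto. unfold N1 in HN; lia.
        -- right. unfold c. field. lra.
    + intros x N Hx. exists c. split; [lra|]. exists (Nat.max 4 N). intros q Hq.
      specialize (Hx q ltac:(lia)).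
      pose proof (weight_lower a p q (conj ha0 ha1) Hp ltac:(lia)) as WL.
      apply Rmult_le_compat_l with (r := weight a p q) in Hx; [|lra].
      replace (weight a p q * (c * / weight a p q)) with c in Hx by (field; lra).
      apply Rle_trans with (1 := Hx). right. unfold weight. ring.
  - intros b Hb. destruct (Rle_lt_dec b 1) as [|L]; [assumption|exfalso].
    assert (b <= (1 + b) / 2); [|lra].
    apply Hb. split; [lra|]. apply hausdorff_null_gt1. lra.
Qed.
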